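(* Let $I=\mathbb Z$ or $I=\mathbb Z^+=\{0,1,2,\dots\}$, let $0<p\le 1$, let $g:I\to[0,\infty)$ be an admissible rate function, let $\theta,\sigma\in(\underline\theta,\bar\theta)$, and let $\hat\mu$ be a probability measure on $I$. Then the shock measures $\underline\nu_j$ ($j\in\mathbb Z$) built from $\theta,\sigma,\hat\mu$ satisfy the random walking shock property, with some non-negative numbers $P$ and $Q$, in exactly the following cases: 1. $I=\mathbb Z^+$, $g(y)=\mathfrak a\,y$ with $\mathfrak a>0$, $\theta=\sigma$, $\hat\mu=\mu^\theta=\mu^\sigma$; then $P=p\,\mathfrak a$ and $Q=(1-p)\,\mathfrak a$. 2. $I=\mathbb Z^+$, $g(y)=\mathfrak a\,(1-e^{-\beta y})$, $p=1$, $\beta,\mathfrak a>0$, $\theta+\beta=\sigma<\ln\mathfrak a$, $\hat\mu=\mu^\sigma$; then $P=(1-e^{-\beta})(\mathfrak a-e^{\sigma})$ and $Q=0$. 3. $I=\mathbb Z^+$, $g(y)=\mathfrak a\,(e^{\beta y}-1)$, $p=1$, $\beta,\mathfrak a>0$, $\sigma=\theta-\beta$, $\hat\mu=\mu^\sigma$; then $P=(e^{\beta}-1)(e^{\sigma}+\mathfrak a)$ and $Q=0$. 4. $I=\mathbb Z$, $g(y)=\mathfrak a\,e^{\beta y}+\mathfrak b$, $p=1$, $\beta,\mathfrak a>0$, $\mathfrak b\ge 0$, $\ln\mathfrak b<\sigma=\theta-\beta$ (with $\ln 0=-\infty$), $\hat\mu=\mu^\sigma$; then $P=(e^{\beta}-1)(e^{\sigma}-\mathfrak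 b)$ and $Q=0$.
   Context: **Zero range process.** $I=\mathbb Z$ or $I=\mathbb Z^+=\{0,1,2,\dots\}$ is the set of possible occupation numbers of a site; the state space is $I^{\mathbb Z}$. A particle jumps from site $i$ with rate $g(\omega_i)$, to $i+1$ with probability $p$ and to $i-1$ with probability $1-p$, $0<p\le 1$. An admissible rate function $g:I\to[0,\infty)$ is non-decreasing and not constant; if $I=\mathbb Z^+$ then $g(0)=0$ and $g(y)>0$ for $y\ge 1$; if $I=\mathbb Z$ then $g(y)>0$ for all $y$. For $\underline\omega\in I^{\mathbb Z}$, $\underline\omega^{i,j}$ is the configuration with $(\underline\omega^{i,j})_i=\omega_i-1$, $(\underline\omega^{i,j})_j=\omega_j+1$, and all other coordinates unchanged. **Stationary marginals.** Define $g(0)!=1$, $g(z)!=\prod_{y=1}^z g(y)$ for $z>0$, and $g(z)!=1/\prod_{y=z+1}^0 g(y)$ for $z<0$. Put $\bar\theta=\lim_{z\to\infty}\ln g(z)$, and $\underline\theta=\lim_{z\to-\infty}\ln g(z)$ if $I=\mathbb Z$, $\underline\theta=-\infty$ if $I=\mathbb Z^+$. For $\underline\theta<\theta<\bar\theta$, $\mu^\theta$ is the probability measure on $I$ given by $\mu^\theta(z)=\frac{1}{Z(\theta)}\frac{e^{\theta z}}{g(z)!}$, $Z(\theta)=\sum_{z\in I}\frac{e^{\theta z}}{g(z)!}$. **Coupled dynamics.** On pairs $(\underline\omega,\underline\zeta)$ with $\omega_i\le\zeta_i$ for all $i$, the (basic coupling) generator is $$\begin{aligned}(L\varphi)(\underline\omega,\underline\zeta)=\sum_{i\in\mathbb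 Z}\Big\{&p\,g(\omega_i)\big[\varphi(\underline\omega^{i,i+1},\underline\zeta^{i,i+1})-\varphi(\underline\omega,\underline\zeta)\big]+p\,[g(\zeta_i)-g(\omega_i)]\big[\varphi(\underline\omega,\underline\zeta^{i,i+1})-\varphi(\underline\omega,\underline\zeta)\big]\\&+(1-p)g(\omega_i)\big[\varphi(\underline\omega^{i,i-1},\underline\zeta^{i,i-1})-\varphi(\underline\omega,\underline\zeta)\big]+(1-p)[g(\zeta_i)-g(\omega_i)]\big[\varphi(\underline\omega,\underline\zeta^{i,i-1})-\varphi(\underline\omega,\underline\zeta)\big]\Big\}.\end{aligned}$$ There are $\zeta_i-\omega_i$ second class particles at site $i$. $S(t)$ denotes the corresponding evolution (semigroup). **Shock measure.** For $\theta,\sigma\in(\underline\theta,\bar\theta)$ and a probability measure $\hat\mu$ on $I$, let $\nu^\theta(y,z)=\mu^\theta(y)$ if $y=z$ and $0$ otherwise, and $\hat\nu(y,z)=\hat\mu(y)$ if $z=y+1$ and $0$ otherwise; these are probability measures on $I\times I$. For $j\in\mathbb Z$, $\underline\nu_j$ is the product measure over sites $i\in\mathbb Z$ for $(\omega_i,\zeta_i)$ with marginal $\nu^\theta$ at sites $i<j$, $\hat\nu$ at $i=j$, and $\nu^\sigma$ at sites $i>j$. **Random walking shock property.** There are non-negative numbers $P,Q$ (which may depend on $\theta,\sigma$, but not on $j$) such that for every $j\in\mathbb Z$ $$\frac{d}{dt}\underline\nu_jS(t)\Big|_{t=0}=P\,[\underline\nu_{j+1}-\underline\nu_j]+Q\,[\underline\nu_{j-1}-\underline\nu_j].$$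 The derivative is understood through the generator: for every bounded function $\varphi$ depending on finitely many sites, $L\varphi$ is $\underline\nu_j$-integrable and $\int L\varphi\,d\underline\nu_j=P\big(\int\varphi\,d\underline\nu_{j+1}-\int\varphi\,d\underline\nu_j\big)+Q\big(\int\varphi\,d\underline\nu_{j-1}-\int\varphi\,d\underline\nu_j\big)$. *)

(* Defs.v *)
From HB Require Import structures.
From mathcomp Require Import all_boot all_order all_algebra.
From mathcomp Require Import all_classical all_reals all_analysis.

Set Implicit Arguments.
Unset Strict Implicit.
Unset Printing Implicit Defensive.
Import Order.TTheory GRing.Theory Num.Theory.
Import numFieldNormedType.Exports.
Local Open Scope classical_set_scope.
Local Open Scope ring_scope.

HB.instance Definition _ := isPointed.Build int 0.

Inductive occupation_range := NonNegInts | AllInts.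

(* Occupation numbers are of type [int] throughout; functions and mass
   functions on the range are given on [int], and rate functions are only
   ever constrained on [occ I]. *)
Definition occ (I : occupation_range) : set int :=
  match I with
  | NonNegInts => [set z | 0 <= z]
  | AllInts => setT
  end.

Section rates.
Context {R : realType}.
Implicit Types (I : occupation_range) (g : int -> R) (theta : R).

Definition admissible I g : Prop :=
  [/\ forall y, occ I y -> 0 <= g y,
      forall y z, occ I y -> occ I z -> y <= z -> g y <= g z,
      exists y z, [/\ occ I y, occ I z & g y <> g z]
    & match I with
      | NonNegInts => g 0 = 0 /\ forall y, 1 <= y -> 0 < g y
      | AllInts => forall y, 0 < g y
      end].

(* [g(z)!]; for [z = Negz n = - n.+1] the product runs over
   [y = z + 1, ..., 0], that is [y = - k] with [0 <= k <= n]. *)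
Definition gfact g (z : int) : R :=
  match z with
  | Posz n => \prod_(1 <= y < n.+1) g y%:Z
  | Negz n => (\prod_(0 <= k < n.+1) g (- k%:Z))^-1
  end.

(* [lne] is the extended logarithm, with [lne 0 = -oo]. *)
Definition theta_sup g : \bar R := limn (fun n : nat => lne (g n%:Z)%:E).

Definition theta_inf I g : \bar R :=
  match I with
  | NonNegInts => -oo%E
  | AllInts => limn (fun n : nat => lne (g (- n%:Z))%:E)
  end.

Definition weight g theta (z : int) : R := expR (theta * z%:~R) / gfact g z.

Definition partition_function I g theta : \bar R :=
  \esum_(z in occ I) (weight g theta z)%:E.

Definition stationary_marginal I g theta (z : int) : R :=
  if z \in occ I then weight g theta z / fine (partition_function I g theta)
  else 0.

Definition mass_function I (m : int -> R) : Prop :=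
  [/\ forall z, 0 <= m z,
      forall z, ~ occ I z -> m z = 0
    & \esum_(z in [set: int]) (m z)%:E = 1%E].

End rates.

(* A configuration of the coupled process: [(eta i).1] is [omega_i] and
   [(eta i).2] is [zeta_i]. *)
Notation pair_config := (int -> int * int).

Definition coordinate_events : set (set pair_config) :=
  [set C | exists (i : int) (A : set (int * int)), C = [set eta | A (eta i)]].

(* The product sigma-algebra, the countable set of pairs being discrete. *)
Definition pair_space := g_sigma_algebraType coordinate_events.

Section shock.
Context {R : realType}.
Implicit Types (I : occupation_range) (p : R) (g : int -> R).

Definition is_product_measure (mu : probability pair_space R)
    (m : int -> int * int -> R) : Prop :=
  forall (s : seq int) (A : int -> set (int * int)), uniq s ->
    mu [set eta : pair_config | forall i, i \in s -> A i (eta i)] =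
    (\prod_(i <- s) \esum_(a in A i) (m i a)%:E)%E.

Definition diagonal (m : int -> R) (a : int * int) : R :=
  if a.1 == a.2 then m a.1 else 0.

Definition one_discrepancy (m : int -> R) (a : int * int) : R :=
  if a.2 == a.1 + 1 then m a.1 else 0.

Definition shock_marginals I g (theta sigma : R) (muhat : int -> R) (j i : int)
    : int * int -> R :=
  if i < j then diagonal (stationary_marginal I g theta)
  else if i == j then one_discrepancy muhat
  else diagonal (stationary_marginal I g sigma).

Definition move (i j : int) (w : int -> int) : int -> int :=
  fun k => if k == i then w k - 1 else if k == j then w k + 1 else w k.

Definition move_both (i j : int) (eta : pair_config) : pair_config :=
  fun k => (move i j (fun l => (eta l).1) k, move i j (fun l => (eta l).2) k).

Definition move_second (i j : int) (eta : pair_config) : pair_config :=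
  fun k => ((eta k).1, move i j (fun l => (eta l).2) k).

(* [\sum_(i \in setT)] adds the nonzero terms, of which there are finitely
   many as soon as [phi] depends on finitely many sites. *)
Definition generator p g (phi : pair_config -> R) (eta : pair_config) : R :=
  \sum_(i \in [set: int])
    (p * g (eta i).1 * (phi (move_both i (i + 1) eta) - phi eta)
     + p * (g (eta i).2 - g (eta i).1)
         * (phi (move_second i (i + 1) eta) - phi eta)
     + (1 - p) * g (eta i).1 * (phi (move_both i (i - 1) eta) - phi eta)
     + (1 - p) * (g (eta i).2 - g (eta i).1)
         * (phi (move_second i (i - 1) eta) - phi eta)).

Definition finitely_many_sites (phi : pair_config -> R) : Prop :=
  exists s : seq int, forall eta eta' : pair_config,
    (forall i, i \in s -> eta i = eta' i) -> phi eta = phi eta'.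

Definition bounded_function (phi : pair_config -> R) : Prop :=
  exists M : R, forall eta, `|phi eta| <= M.

Definition random_walking_shock p g (nu : int -> probability pair_space R)
    (P Q : R) : Prop :=
  [/\ 0 <= P, 0 <= Q &
    forall (j : int) (phi : pair_config -> R),
      finitely_many_sites phi -> bounded_function phi ->
      (nu j).-integrable setT (fun eta => (generator p g phi eta)%:E) /\
      Rintegral (nu j) setT (generator p g phi) =
        P * (Rintegral (nu (j + 1)) setT phi - Rintegral (nu j) setT phi)
        + Q * (Rintegral (nu (j - 1)) setT phi - Rintegral (nu j) setT phi)].

End shock.

(* Main.v *)
(* Raising one coordinate of a stationary site is a change of variables whose
   density is the jump rate: g(y) mu(y) = e^theta mu(y - 1).  Hence, under the
   shock measure, every bond away from the second class particle contributes a
   difference of two neighbouring shifted means of phi, these differences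
   telescope, and the mean of L phi only involves phi and its shifts at j - 1, j
   and j + 1.

   If muhat = mu^sigma and g(y + 1) = e^(theta - sigma) g(y) + c, the jumps of
   the second class particle turn nu_j into a multiple of nu_(j +- 1) and the
   remaining terms cancel.  Conversely, indicators of configurations on the sites
   -1, 0, 1 give three families of equations, according to where the second class
   particle is put: at 0 they force muhat = mu^sigma, p = 1 or theta = sigma, and
   the affine recursion for g; at 1 and -1 they determine P and Q.  Solving the
   recursion under positivity and monotonicity leaves the four cases. *)

Require Import Defs.
From mathcomp Require Import all_boot all_order all_algebra.
From mathcomp Require Import all_classical all_reals all_analysis.
From mathcomp Require Import measurable_realfun ring lra zify.

Set Implicit Arguments.
Unset Strict Implicit.
Unset Printing Implicit Defensive.
Import Order.TTheory GRing.Theory Num.Theory.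
Local Open Scope classical_set_scope.
Local Open Scope ring_scope.

(** * Cylinder functions and sums over finite windows *)

Definition depends_on (T : Type) (s : seq int) (F : pair_config -> T) :=
  forall eta eta' : pair_config,
    (forall i, i \in s -> eta i = eta' i) -> F eta = F eta'.

(** Each class of configurations agreeing on [s] has exactly one member here, so integrals of
    functions of the sites [s] become sums over this countable set. *)
Definition window (s : seq int) : set pair_config :=
  [set x | forall i, i \notin s -> x i = (0, 0)].

Definition restrict (s : seq int) (x : pair_config) : pair_config :=
  fun i => if i \in s then x i else (0, 0).

Definition config_mass {R : realType} (m : int -> int * int -> R) (s : seq int)
    (x : pair_config) : R :=
  \prod_(i <- s) m i (x i).

Lemma eq_restrict s x i : i \in s -> restrict s x i = x i.
Proof. by rewrite /restrict => ->. Qed.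

Lemma window_restrict s x : window s (restrict s x).
Proof. by move=> i /negbTE si; rewrite /restrict si. Qed.

Lemma depends_on_sub T (s s' : seq int) (F : pair_config -> T) :
  {subset s <= s'} -> depends_on s F -> depends_on s' F.
Proof. by move=> ss' Fs eta eta' e; apply: Fs => i /ss'; apply: e. Qed.

Section product_measure.
Context {R : realType}.
Implicit Types (mu : probability pair_space R) (s : seq int)
  (m : int -> int * int -> R).

(** Numbering the values on [s] cuts the space into cylinders indexed by [nat], as countable unions
    require. *)
Let code s (x : pair_config) : nat := pickle (map x s).

Let code_eq s x y : code s x = code s y <-> forall i, i \in s -> x i = y i.
Proof.
split=> [|e]; last by rewrite /code; congr pickle; exact/eq_in_map.
by move=> /(pcan_inj pickleK)/eq_in_map.
Qed.

Lemma measurable_coordinate (i : int) (A : set (int * int)) :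
  measurable ([set eta : pair_config | A (eta i)] : set pair_space).
Proof. by apply: sub_sigma_algebra; exists i, A. Qed.

Lemma measurable_cylinder s (x : pair_config) :
  measurable ([set eta : pair_config | forall i, i \in s -> eta i = x i]
    : set pair_space).
Proof.
elim: s => [|i s IHs].
  rewrite (_ : [set _ | _] = setT); first exact: measurableT.
  by apply/seteqP; split.
rewrite (_ : [set _ | _] = [set eta : pair_config | [set x i] (eta i)] `&`
    [set eta : pair_config | forall k, k \in s -> eta k = x k]).
  by apply: measurableI => //; exact: measurable_coordinate.
apply/seteqP; split=> eta /=.
  by move=> e; split=> [|k ks]; apply: e; rewrite inE ?eqxx ?ks ?orbT.
by case=> ei es k; rewrite inE => /predU1P[->|/es].
Qed.

Let measurable_code s (n : nat) :
  measurable ([set eta : pair_config | code s eta = n] : set pair_space).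
Proof.
have [[x xn]|noc] := pselect (exists x : pair_config, code s x = n); last first.
  rewrite (_ : [set _ | _] = set0); first exact: measurable0.
  by apply/seteqP; split=> // eta /= e; apply: noc; exists eta.
rewrite (_ : [set _ | _] =
    [set eta : pair_config | forall i, i \in s -> eta i = x i]).
  exact: measurable_cylinder.
by apply/seteqP; split=> eta /=; rewrite -xn => /code_eq.
Qed.

Let bigcup_code s :
  \bigcup_n [set eta : pair_config | code s eta = n] = setT.
Proof. by apply/seteqP; split=> // eta _; exists (code s eta). Qed.

(** [F] is constant on each of the countably many measurable cylinders given by [code s]. *)
Lemma measurable_depends_on d (T : measurableType d) s (F : pair_config -> T) :
  depends_on s F -> measurable_fun setT (F : pair_space -> T).
Proof.
move=> Fs; rewrite -(bigcup_code s).
apply/measurable_fun_bigcup => [n|n]; first exact: measurable_code.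
have [[x xn]|noc] := pselect (exists x : pair_config, code s x = n); last first.
  rewrite (_ : [set _ | _] = set0); first exact: measurable_fun_set0.
  by apply/seteqP; split=> // eta /= e; apply: noc; exists eta.
apply: (eq_measurable_fun (cst (F x))); last exact: measurable_cst.
move=> eta /[!inE]/= en; apply: Fs.
by apply/code_eq; rewrite xn en.
Qed.

Lemma product_measure_cylinder mu m s (x : pair_config) :
  is_product_measure mu m -> (forall i a, 0 <= m i a) -> uniq s ->
  mu [set eta : pair_config | forall i, i \in s -> eta i = x i] =
  (config_mass m s x)%:E.
Proof.
move=> mum m0 us; rewrite [LHS](mum s (fun i => [set x i]) us).
rewrite -prodEFin; apply: eq_bigr => i _.
by rewrite esum_set1 ?lee_fin.
Qed.

(** The integral splits along the values of [code s]. On each piece [F] is constant and the measure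
    is a [config_mass]; the codes are then renamed by their representatives in the window. *)
Lemma integral_depends_on mu m s (F : pair_config -> R) :
  is_product_measure mu m -> (forall i a, 0 <= m i a) -> uniq s ->
  depends_on s F -> (forall x, 0 <= F x) ->
  (\int[mu]_eta (F eta)%:E =
   \esum_(x in window s) (F x * config_mass m s x)%:E)%E.
Proof.
move=> mum m0 us Fs F0.
pose E n := [set eta : pair_config | code s eta = n].
have mF : measurable_fun [set: pair_space] (EFin \o F).
  by apply/measurable_EFinP; exact: measurable_depends_on Fs.
rewrite -(bigcup_code s) ge0_integral_bigcup; first last.
- by move=> n n' _ _ [eta [/= <- <-]].
- by move=> eta _; rewrite lee_fin.
- by rewrite bigcup_code.
- by move=> n; exact: measurable_code.
rewrite nneseries_esumT; last first.
  by move=> n; apply: integral_ge0 => eta _; rewrite lee_fin.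
(* [restrict s] preserves codes, so a code that no point of the window has belongs to an empty
   cylinder. *)
rewrite (_ : esum _ _ = \esum_(n in code s @` window s)
    (\int[mu]_(eta in E n) (F eta)%:E)%E); last first.
  rewrite [RHS]esum_mkcond; apply: eq_esum => n _.
  case: ifPn => // /negP; rewrite inE => ninim.
  rewrite [X in integral _ X](_ : _ = set0) ?integral_set0 //.
  apply/seteqP; split=> // eta /= en; apply: ninim.
  exists (restrict s eta); first exact: window_restrict.
  by rewrite -en; apply/code_eq => i; exact: eq_restrict.
rewrite (reindex_esum (window s) (code s @` window s) (code s)); last first.
  split => // x y; rewrite !inE => wx wy /code_eq exy; apply/funext => i.
  by have [/exy //|si] := boolP (i \in s); rewrite wx // wy.
apply: eq_esum => x wx.
have -> : E (code s x) = [set eta : pair_config | forall i, i \in s -> eta i = x i].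
  by apply/seteqP; split=> eta /= /code_eq.
rewrite (eq_integral (cst (F x)%:E)); last first.
  by move=> eta /[!inE]/= e; rewrite (Fs eta x).
rewrite integral_cst; last exact: measurable_cylinder.
by rewrite EFinM; congr (_ * _)%E; exact: product_measure_cylinder.
Qed.

End product_measure.

(** * Means and changes of variables *)

Lemma depends_on_comp T U s (h : T -> U) (F : pair_config -> T) :
  depends_on s F -> depends_on s (h \o F).
Proof. by move=> Fs x y e /=; rewrite (Fs x y). Qed.

Section has_mean.
Context {R : realType}.
Implicit Types (mu : probability pair_space R) (F G : pair_config -> R)
  (m : int -> int * int -> R).

(** Integrability is kept with the value because [Rintegral] is a real number even for an integrand
    that is not integrable, and the shock property asks for both. *)
Definition has_mean mu F (v : R) : Prop :=
  mu.-integrable setT (fun eta => (F eta)%:E) /\ Rintegral mu setT F = v.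

Lemma has_mean_ext mu F G v : F =1 G -> has_mean mu F v -> has_mean mu G v.
Proof. by move=> /funext ->. Qed.

Lemma has_mean_unique mu F v v' : has_mean mu F v -> has_mean mu F v' -> v = v'.
Proof. by move=> [_ <-] [_ <-]. Qed.

Lemma has_meanD mu F G v w : has_mean mu F v -> has_mean mu G w ->
  has_mean mu (fun x => F x + G x) (v + w).
Proof.
move=> [iF <-] [iG <-]; split.
  exact: (@integrableD _ _ _ mu setT measurableT _ _ iF iG).
exact: (@RintegralD _ _ _ mu setT F G measurableT iF iG).
Qed.

Lemma has_meanZ mu F v c : has_mean mu F v ->
  has_mean mu (fun x => c * F x) (c * v).
Proof.
move=> [iF <-]; split.
  exact: (@integrableZl _ _ _ mu setT measurableT c _ iF).
exact: (@RintegralZl _ _ _ mu setT F c measurableT iF).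
Qed.

Lemma has_meanB mu F G v w : has_mean mu F v -> has_mean mu G w ->
  has_mean mu (fun x => F x - G x) (v - w).
Proof.
move=> Fv Gw; have := has_meanD Fv (has_meanZ (-1) Gw); rewrite mulN1r.
by apply: has_mean_ext => x; rewrite mulN1r.
Qed.

Lemma has_mean_cst mu c : has_mean mu (fun=> c) c.
Proof.
split; first exact: (@finite_measure_integrable_cst _ _ _ mu).
rewrite (@Rintegral_cst _ _ _ mu setT measurableT) -[RHS]mulr1.
by congr (c * _); rewrite -[RHS]/(fine 1%:E) -(@probability_setT _ _ _ mu).
Qed.

Lemma has_mean_sum mu (n : nat) (F : nat -> pair_config -> R) (v : nat -> R) :
  (forall k, has_mean mu (F k) (v k)) ->
  has_mean mu (fun x => \sum_(k < n) F k x) (\sum_(k < n) v k).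
Proof.
move=> Fv; elim: n => [|n IHn].
  rewrite big_ord0; apply: has_mean_ext (has_mean_cst mu 0) => x.
  by rewrite big_ord0.
rewrite big_ord_recr; apply: has_mean_ext (has_meanD IHn (Fv n)) => x.
by rewrite big_ord_recr.
Qed.

Lemma has_mean_bounded mu s F : depends_on s F -> bounded_function F ->
  has_mean mu F (Rintegral mu setT F).
Proof.
move=> Fs [M FM]; split=> //.
apply: (@measurable_bounded_integrable _ _ _ mu F setT measurableT).
- by rewrite [X in (X < _)%E](@probability_setT _ _ _ mu) ltry.
- exact: measurable_depends_on Fs.
exists M; split; first exact: num_real.
by move=> N MN x _; rewrite /= (le_trans (FM x)) ?ltW.
Qed.

Section change_of_variables.
Variables (mu mu' : probability pair_space R) (m m' : int -> int * int -> R).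
Variables (s : seq int) (t t' : pair_config -> pair_config).
Hypotheses (mum : is_product_measure mu m) (mum' : is_product_measure mu' m').
Hypotheses (m0 : forall i a, 0 <= m i a) (m0' : forall i a, 0 <= m' i a).
Hypothesis us : uniq s.
Hypotheses (tK : cancel t t') (tK' : cancel t' t).
Hypotheses (ts : forall x i, i \notin s -> t x i = x i)
  (ts' : forall x i, i \notin s -> t' x i = x i).

Let bij_t : set_bij (window s) (window s) t.
Proof.
split=> [x wx i si|x y _ _|y wy].
- by rewrite ts ?wx.
- exact: (can_inj tK).
by exists (t' y); [move=> i si; rewrite ts' ?wy|rewrite tK'].
Qed.

Let integral_change F F' : depends_on s F -> depends_on s F' ->
  (forall x, 0 <= F x) -> (forall x, 0 <= F' x) ->
  (forall x, F x * config_mass m s x = F' (t x) * config_mass m' s (t x)) ->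
  (\int[mu]_eta (F eta)%:E = \int[mu']_eta (F' eta)%:E)%E.
Proof.
move=> Fs Fs' F0 F0' e.
rewrite (integral_depends_on mum m0 us Fs F0).
rewrite (integral_depends_on mum' m0' us Fs' F0').
by rewrite [RHS](reindex_esum _ _ _ _ bij_t); apply: eq_esum => x _; rewrite e.
Qed.

(** The bijection [t] of the window matches the two sums term by term. This is done for nonnegative
    functions; the absolute value then transfers integrability, and the positive and negative parts
    transfer the integral. *)
Lemma has_mean_change F F' v : depends_on s F -> depends_on s F' ->
  (forall x, F x * config_mass m s x = F' (t x) * config_mass m' s (t x)) ->
  has_mean mu' F' v -> has_mean mu F v.
Proof.
move=> Fs Fs' e [/integrableP[_ iF'] <-].
have W0 x : 0 <= config_mass m s x by apply: prodr_ge0.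
have W0' x : 0 <= config_mass m' s x by apply: prodr_ge0.
(* The masses are nonnegative, so the termwise identity survives any positively homogeneous [h], in
   particular the two parts and the norm. *)
have maxE (h : R -> R) : (forall r w, 0 <= w -> h r * w = h (r * w)) ->
    forall x, (h \o F) x * config_mass m s x =
              (h \o F') (t x) * config_mass m' s (t x).
  by move=> hM x; rewrite /= !hM // e.
have pos : (\int[mu]_eta (Num.max (F eta) 0)%:E =
            \int[mu']_eta (Num.max (F' eta) 0)%:E)%E.
  apply: (@integral_change (Num.max^~ 0 \o F) (Num.max^~ 0 \o F')).
  - exact: depends_on_comp.
  - exact: depends_on_comp.
  - by move=> x; rewrite /= le_max lexx orbT.
  - by move=> x; rewrite /= le_max lexx orbT.
  - by apply: (maxE (Num.max^~ 0)) => r w w0; rewrite maxr_pMl // mul0r.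
have neg : (\int[mu]_eta (Num.max (- F eta) 0)%:E =
            \int[mu']_eta (Num.max (- F' eta) 0)%:E)%E.
  apply: (@integral_change ((fun r => Num.max (- r) 0) \o F)
                           ((fun r => Num.max (- r) 0) \o F')).
  - exact: depends_on_comp.
  - exact: depends_on_comp.
  - by move=> x; rewrite /= le_max lexx orbT.
  - by move=> x; rewrite /= le_max lexx orbT.
  - apply: (maxE (fun r => Num.max (- r) 0)) => r w w0.
    by rewrite maxr_pMl // mul0r mulNr.
have abs : (\int[mu]_eta (`|F eta|)%:E = \int[mu']_eta (`|F' eta|)%:E)%E.
  apply: (@integral_change (Num.norm \o F) (Num.norm \o F')) => //.
  - exact: depends_on_comp.
  - exact: depends_on_comp.
  - by move=> x /=.
  - by move=> x /=.
  - by apply: maxE => r w w0; rewrite normrM (ger0_norm w0).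
split.
  apply/integrableP; split.
    by apply/measurable_EFinP; exact: measurable_depends_on Fs.
  by rewrite [X in (X < _)%E]abs.
congr fine; rewrite integralE [RHS]integralE.
congr (_ - _)%E.
- by rewrite (funerpos F) (funerpos F').
- by rewrite (funerneg F) (funerneg F').
Qed.

End change_of_variables.

End has_mean.

(** * Moving particles under a product measure *)

Definition shift_pair (d : int) (a : int * int) : int * int := (a.1 + d, a.2 + d).

Definition shift_at (k d : int) (x : pair_config) : pair_config :=
  fun i => if i == k then shift_pair d (x i) else x i.

Lemma shift_atK k d : cancel (shift_at k d) (shift_at k (- d)).
Proof.
move=> x; apply/funext => i; rewrite /shift_at; case: eqP => // _.
by rewrite /shift_pair /= !addrK; case: (x i).
Qed.

Lemma shift_atNK k d : cancel (shift_at k (- d)) (shift_at k d).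
Proof. by move=> x; rewrite -{1}(opprK d) shift_atK. Qed.

Lemma depends_on_shift_at T (s : seq int) (F : pair_config -> T) k d :
  depends_on s F -> depends_on s (fun x => F (shift_at k d x)).
Proof. by move=> Fs x y e; apply: Fs => i /e; rewrite /shift_at => ->. Qed.

Lemma depends_on_move_both T (s : seq int) (F : pair_config -> T) i k :
  depends_on s F -> depends_on s (fun x => F (move_both i k x)).
Proof. by move=> Fs x y e; apply: Fs => l /e; rewrite /move_both /move => ->. Qed.

Lemma depends_on_move_second T (s : seq int) (F : pair_config -> T) i k :
  depends_on s F -> depends_on s (fun x => F (move_second i k x)).
Proof. by move=> Fs x y e; apply: Fs => l /e; rewrite /move_second /move => ->. Qed.

Lemma depends_on2 T U V (s : seq int) (h : T -> U -> V) F G :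
  depends_on s F -> depends_on s G -> depends_on s (fun x => h (F x) (G x)).
Proof. by move=> Fs Gs x y e; rewrite (Fs x y) ?(Gs x y). Qed.

Lemma depends_on_site T (s : seq int) (h : int * int -> T) i :
  i \in s -> depends_on s (fun x : pair_config => h (x i)).
Proof. by move=> si x y ->. Qed.

Lemma move_second_opp i k : i != k ->
  cancel (move_second i k) (move_second k i).
Proof.
move=> ik x; apply/funext => l; rewrite /move_second /move /=.
have [->|li] := eqVneq l i; last first.
  have [lk|_] := eqVneq l k; last by case: (x l).
  by rewrite addrK; case: (x l).
by rewrite (negbTE ik) subrK; case: (x i).
Qed.

(** After summation by parts at [i] a jump from [i] to [k] acts as an added pair at [k]. This is
    what produces differences of shifted means. *)
Lemma move_both_shift_at i k x : i != k ->
  move_both i k (shift_at i 1 x) = shift_at k 1 x.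
Proof.
move=> ik; apply/funext => l; rewrite /move_both /move /shift_at /shift_pair.
have [->|li] := eqVneq l i; first by rewrite (negbTE ik) /= !addrK; case: (x i).
by case: eqP => // _; case: (x l).
Qed.

Section weighted.
Context {R : realType}.
Implicit Types (mu : probability pair_space R) (F G psi : pair_config -> R)
  (m : int -> int * int -> R).

Lemma config_massD1 m s i x : uniq s -> i \in s ->
  config_mass m s x = m i (x i) * \prod_(k <- s | k != i) m k (x k).
Proof. by move=> us si; rewrite /config_mass (bigD1_seq i). Qed.

Lemma has_mean_ae mu m s i F G v :
  is_product_measure mu m -> (forall i a, 0 <= m i a) ->
  depends_on s F -> depends_on s G ->
  (forall x, m i (x i) != 0 -> F x = G x) ->
  has_mean mu G v -> has_mean mu F v.
Proof.
(* The site [i] is adjoined so that the factor [m i (x i)] occurs in the mass; where it vanishes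
   both sides are 0. *)
move=> mum m0 Fs Gs FG; pose s' := undup (i :: s).
have ss' : {subset s <= s'} by move=> k ks; rewrite mem_undup inE ks orbT.
have us' : uniq s' by apply: undup_uniq.
apply: (@has_mean_change _ _ _ _ _ s' id id mum mum) => //.
- exact: depends_on_sub ss' Fs.
- exact: depends_on_sub ss' Gs.
move=> x /=; have [mx|/FG -> //] := eqVneq (m i (x i)) 0.
by rewrite (@config_massD1 _ _ i) ?mx ?mul0r ?mulr0 // mem_undup mem_head.
Qed.

(* Summation by parts at one site: the weight [f] is, up to [e], the ratio of
   the masses after and before lowering both occupation numbers. *)
Lemma has_mean_rate mu m s i (f : int * int -> R) (e : R) psi v :
  is_product_measure mu m -> (forall i a, 0 <= m i a) ->
  (forall a, f a * m i a = e * m i (shift_pair (-1) a)) ->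
  depends_on s psi ->
  has_mean mu (fun x => psi (shift_at i 1 x)) v ->
  has_mean mu (fun x => f (x i) * psi x) (e * v).
Proof.
move=> mum m0 fe psis psiv; pose s' := undup (i :: s).
have ss' : {subset s <= s'} by move=> k ks; rewrite mem_undup inE ks orbT.
have is' : i \in s' by rewrite mem_undup mem_head.
have us' : uniq s' by apply: undup_uniq.
have psis' := depends_on_sub ss' psis.
apply: (@has_mean_change _ mu mu m m s' (shift_at i (-1)) (shift_at i 1) mum mum
  m0 m0 us' _ _ _ _ _ (fun x => e * psi (shift_at i 1 x))).
- exact: shift_atNK.
- exact: shift_atK.
- move=> x k ks; rewrite /shift_at; case: eqP => // ki.
  by rewrite ki is' in ks.
- move=> x k ks; rewrite /shift_at; case: eqP => // ki.
  by rewrite ki is' in ks.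
- by apply: depends_on2 psis'; exact: depends_on_site.
- apply: (depends_on2 *%R); first by move=> x y.
  exact: depends_on_shift_at.
- move=> x; rewrite shift_atNK !(@config_massD1 _ _ i) //.
  have -> : \prod_(k <- s' | k != i) m k (shift_at i (-1) x k) =
      \prod_(k <- s' | k != i) m k (x k).
    by apply: eq_bigr => k /negbTE ki; rewrite /shift_at ki.
  by rewrite /shift_at eqxx mulrACA fe; ring.
exact: has_meanZ.
Qed.

(** The jump itself is the change of variables. The masses of [mu] and [mu'] differ only in the
    factors at [i] and [k], where the hypothesis on [f] compares them; the case of interest is [mu]
    and [mu'] being two neighbouring shock measures. *)
Lemma has_mean_move_second mu mu' m m' s i k (f : int * int -> R) (e : R) psi v :
  is_product_measure mu m -> is_product_measure mu' m' ->
  (forall i a, 0 <= m i a) -> (forall i a, 0 <= m' i a) ->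
  i != k -> (forall l, l != i -> l != k -> m l = m' l) ->
  (forall a b, f a * (m i a * m k b) =
               e * (m' i (a.1, a.2 - 1) * m' k (b.1, b.2 + 1))) ->
  depends_on s psi -> has_mean mu' psi v ->
  has_mean mu (fun x => f (x i) * psi (move_second i k x)) (e * v).
Proof.
move=> mum mum' m0 m0' ik mm' fe psis psiv; pose s' := undup (i :: k :: s).
have ss' : {subset s <= s'} by move=> l ls; rewrite mem_undup !inE ls !orbT.
have is' : i \in s' by rewrite mem_undup mem_head.
have ks' : k \in s' by rewrite mem_undup !inE eqxx orbT.
have us' : uniq s' by apply: undup_uniq.
have psis' := depends_on_sub ss' psis.
have W mm x : config_mass mm s' x = mm i (x i) * mm k (x k) *
    \prod_(l <- s' | (l != i) && (l != k)) mm l (x l) :> R.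
  rewrite (@config_massD1 _ _ i) // -mulrA; congr (_ * _).
  by rewrite -big_filter (bigD1_seq k) ?filter_uniq ?mem_filter ?ks' ?andbT
    1?eq_sym // big_filter_cond.
have outside l (ls : l \notin s') : (l == i = false) * (l == k = false).
  by split; apply: contraNF ls => /eqP ->.
apply: (@has_mean_change _ mu mu' m m' s' (move_second i k) (move_second k i)
  mum mum' m0 m0' us' _ _ _ _ _ (fun x => e * psi x)).
- exact: move_second_opp.
- by apply: move_second_opp; rewrite eq_sym.
- move=> x l ls; rewrite /move_second /move !(outside l ls).
  by case: (x l).
- move=> x l ls; rewrite /move_second /move !(outside l ls).
  by case: (x l).
- apply: (depends_on2 *%R); first exact: depends_on_site.
  exact: depends_on_move_second.
- by apply: (depends_on2 *%R) => // x y.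
- move=> x; rewrite !W.
  have -> : \prod_(l <- s' | (l != i) && (l != k)) m' l (move_second i k x l) =
      \prod_(l <- s' | (l != i) && (l != k)) m l (x l).
    apply: eq_bigr => l /andP[li lk].
    by rewrite mm' // /move_second /move (negbTE li) (negbTE lk); case: (x l).
  have -> : move_second i k x i = ((x i).1, (x i).2 - 1).
    by rewrite /move_second /move eqxx.
  have -> : move_second i k x k = ((x k).1, (x k).2 + 1).
    by rewrite /move_second /move eq_sym (negbTE ik) eqxx.
  by rewrite mulrACA fe; ring.
exact: has_meanZ.
Qed.

End weighted.

(** * The mean of the generator under a shock measure *)

Section bonds.
Context {R : realType}.
Implicit Types (g : int -> R) (phi : pair_config -> R) (m : int -> R).

(** The part of the generator from jumps out of [i] in direction [d], before the factor [p] or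
    [1 - p]. *)
Definition bond_term g (d : int) phi (i : int) (x : pair_config) : R :=
  g (x i).1 * (phi (move_both i (i + d) x) - phi x)
  + (g (x i).2 - g (x i).1) * (phi (move_second i (i + d) x) - phi x).

Lemma generatorE p g phi x :
  generator p g phi x =
  \sum_(i \in [set: int])
    (p * bond_term g 1 phi i x + (1 - p) * bond_term g (-1) phi i x).
Proof. by apply: eq_fsbigr => i _; rewrite /bond_term; ring. Qed.

Lemma bond_term_outside s g d phi i x : depends_on s phi ->
  i \notin s -> i + d \notin s -> bond_term g d phi i x = 0.
Proof.
move=> phis si sd; rewrite /bond_term.
have e l : l \in s -> (l == i = false) * (l == i + d = false).
  by move=> ls; split; apply: contraTF ls => /eqP ->.
rewrite (phis (move_both _ _ _) x); last first.
  by move=> l /e ll; rewrite /move_both /move !ll; case: (x l).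
rewrite (phis (move_second _ _ _) x); last first.
  by move=> l /e ll; rewrite /move_second /move !ll; case: (x l).
by rewrite subrr !mulr0 addr0.
Qed.

Lemma depends_on_bond_term s g d phi i : i \in s -> depends_on s phi ->
  depends_on s (bond_term g d phi i).
Proof.
move=> si phis; apply: (depends_on2 +%R); apply: (depends_on2 *%R).
- exact: (depends_on_site (fun a => g a.1)).
- by apply: (depends_on2 (fun a b => a - b)) => //; exact: depends_on_move_both.
- exact: (depends_on_site (fun a => g a.2 - g a.1)).
- by apply: (depends_on2 (fun a b => a - b)) => //; exact: depends_on_move_second.
Qed.

(* Both sides of [j] are enumerated outwards, so that the bond sums telescope. *)
Lemma generator_window p g phi s (j : int) (N : nat) x : depends_on s phi ->
  (forall i, i \in s -> `|i - j| < N%:Z) ->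
  generator p g phi x =
  \sum_(k < N) (p * bond_term g 1 phi (j + 1 + k%:Z) x
                + (1 - p) * bond_term g (-1) phi (j + 1 + k%:Z) x)
  + \sum_(k < N) (p * bond_term g 1 phi (j - 1 - k%:Z) x
                  + (1 - p) * bond_term g (-1) phi (j - 1 - k%:Z) x)
  + (p * bond_term g 1 phi j x + (1 - p) * bond_term g (-1) phi j x).
Proof.
move=> phis sN; rewrite generatorE.
set c := fun i => p * bond_term g 1 phi i x + (1 - p) * bond_term g (-1) phi i x.
(* The list reaches distance [N], one more than the sites of [s]. A site outside it thus has both
   neighbours outside [s] too, and its bond terms vanish. *)
pose r := [seq j + 1 + k%:Z | k <- iota 0 N] ++
  [seq j - 1 - k%:Z | k <- iota 0 N] ++ [:: j].
have ur : uniq r.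
  rewrite !cat_uniq /= !map_inj_uniq ?iota_uniq //=; first last.
  - by move=> a b; lia.
  - by move=> a b; lia.
  rewrite andbT; apply/andP; split; [|rewrite orbF].
    apply/hasPn => i; rewrite mem_cat inE => /orP[/mapP[a _ ->]|/eqP ->];
      by apply/negP => /mapP[b _]; lia.
  by apply/negP => /mapP[b _]; lia.
rewrite (fsbigE r) //; last first.
  move=> i _ ir; have ji : N%:Z < `|i - j|.
    rewrite ltNge; apply: contra ir => iN.
    rewrite !mem_cat inE; have [ij|ij|_] := ltgtP i j; last by rewrite !orbT.
      apply/orP; right; apply/orP; left; apply/mapP.
      by exists (absz (j - 1 - i)%R); [rewrite mem_iota|]; lia.
    apply/orP; left; apply/mapP.
    by exists (absz (i - 1 - j)%R); [rewrite mem_iota|]; lia.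
  rewrite /c !(bond_term_outside _ _ phis) ?mulr0 ?addr0 //;
    by apply/negP => /sN; lia.
rewrite (eq_bigl xpredT); last by move=> i; rewrite in_setT.
rewrite !big_cat !big_map big_seq1 /= addrA.
by rewrite -(big_mkord xpredT (fun k : nat => c (j + 1 + k%:Z)))
  -(big_mkord xpredT (fun k : nat => c (j - 1 - k%:Z))) /index_iota subn0.
Qed.

End bonds.

Section shock_mean.
Context {R : realType}.
Variables (g : int -> R) (mt ms mh : int -> R) (et es : R)
  (nu : int -> probability pair_space R).

(** This is [shock_marginals] for arbitrary mass functions; below, [et] and [es] stand for the
    exponentials of [theta] and [sigma]. *)
Definition marginals (j i : int) : int * int -> R :=
  if i < j then Defs.diagonal mt else if i == j then one_discrepancy mh
  else Defs.diagonal ms.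

Hypothesis hnu : forall j, is_product_measure (nu j) (marginals j).
Hypotheses (mt0 : forall z, 0 <= mt z) (ms0 : forall z, 0 <= ms z)
  (mh0 : forall z, 0 <= mh z).
Hypotheses (gmt : forall y, g y * mt y = et * mt (y - 1))
  (gms : forall y, g y * ms y = es * ms (y - 1)).

Lemma marginalsE j i a : marginals j i a =
  if i < j then Defs.diagonal mt a else if i == j then one_discrepancy mh a
  else Defs.diagonal ms a.
Proof. by rewrite /marginals; case: ifP => // _; case: ifP. Qed.

Lemma marginals_ge0 j i a : 0 <= marginals j i a.
Proof.
rewrite /marginals /Defs.diagonal /one_discrepancy.
by do 3?case: ifP.
Qed.

Lemma marginals_neq j k i : i != j -> i != k -> (i < j) = (i < k) ->
  marginals j i = marginals k i.
Proof. by rewrite /marginals => /negbTE -> /negbTE -> ->. Qed.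

Let e_ (j i : int) := if i < j then et else es.

Let rate_marginal j i a : i != j ->
  g a.1 * marginals j i a = e_ j i * marginals j i (shift_pair (-1) a).
Proof.
move=> ij; rewrite /marginals (negbTE ij) /e_ /Defs.diagonal /shift_pair /=.
by case: ifP => _; rewrite (inj_eq (addIr _)); case: ifP; rewrite ?mulr0.
Qed.

Definition shifted_mean j phi i := Rintegral (nu j) setT (fun x => phi (shift_at i 1 x)).

Lemma bounded_comp phi (t : pair_config -> pair_config) :
  bounded_function phi -> bounded_function (fun x => phi (t x) : R).
Proof. by move=> [M phiM]; exists M => x. Qed.

Section one_function.
Variables (s : seq int) (phi : pair_config -> R).
Hypotheses (phis : depends_on s phi) (phib : bounded_function phi).

Lemma has_mean_shifted j i :
  has_mean (nu j) (fun x => phi (shift_at i 1 x)) (shifted_mean j phi i).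
Proof.
apply: has_mean_bounded; first exact: depends_on_shift_at phis.
exact: bounded_comp.
Qed.

Lemma has_mean_function j : has_mean (nu j) phi (Rintegral (nu j) setT phi).
Proof. exact: has_mean_bounded phis phib. Qed.

Lemma shifted_mean_outside j i : i \notin s ->
  shifted_mean j phi i = Rintegral (nu j) setT phi.
Proof.
move=> si; congr Rintegral; apply/funext => x; apply: phis => k ks.
by rewrite /shift_at; case: eqP => // ki; rewrite -ki ks in si.
Qed.

(** Away from [j] the two processes agree almost surely, so the gap term drops out; summation by
    parts at [i] handles the common jump. *)
Lemma has_mean_bond_term j i d : i != j -> d != 0 ->
  has_mean (nu j) (bond_term g d phi i)
    (e_ j i * (shifted_mean j phi (i + d) - shifted_mean j phi i)).
Proof.
move=> ij d0; have id : i != i + d by rewrite -{1}[i]addr0 (inj_eq (addrI _)) eq_sym.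
pose psi x := phi (move_both i (i + d) x) - phi x.
have psis : depends_on s psi.
  by apply: (depends_on2 (fun a b => a - b)) => //; exact: depends_on_move_both.
pose s' := i :: s.
have ss' : {subset s <= s'} by move=> k ks; rewrite inE ks orbT.
apply: (@has_mean_ae _ _ (marginals j) s' i _ (fun x => g (x i).1 * psi x)).
- exact: hnu.
- exact: marginals_ge0.
- apply: depends_on_bond_term; first by rewrite mem_head.
  exact: depends_on_sub phis.
- apply: (depends_on2 *%R); last exact: depends_on_sub psis.
  by apply: (depends_on_site (fun a => g a.1)); rewrite mem_head.
- move=> x; rewrite /marginals (negbTE ij) => mx.
  suff e : (x i).2 = (x i).1.
    by rewrite /bond_term -/(psi x) e subrr mul0r addr0.
  by move: mx; case: ifP => _; rewrite /Defs.diagonal; case: ifP => [/eqP -> //|_]; rewrite eqxx.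
apply: (@has_mean_rate _ _ (marginals j) s i (fun a => g a.1)) => //.
- exact: marginals_ge0.
- by move=> a; exact: rate_marginal.
apply: has_mean_ext (has_meanB (has_mean_shifted j (i + d)) (has_mean_shifted j i)).
by move=> x; rewrite /psi move_both_shift_at.
Qed.

End one_function.

(** On either side of [j] the bond means telescope. The far ends give the plain mean [E], as a shift
    outside [s] does not affect [phi]; the near ends leave shifted means at [j - 1], [j] and
    [j + 1]. The bonds out of [j] itself stay as [v] and [w]. *)
Lemma has_mean_generator s phi p j v w :
  depends_on s phi -> bounded_function phi ->
  has_mean (nu j) (bond_term g 1 phi j) v ->
  has_mean (nu j) (bond_term g (-1) phi j) w ->
  let E := Rintegral (nu j) setT phi in
  has_mean (nu j) (generator p g phi)
    (p * (et * (shifted_mean j phi j - E)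
          + es * (E - shifted_mean j phi (j + 1)) + v)
     + (1 - p) * (es * (shifted_mean j phi j - E)
          + et * (E - shifted_mean j phi (j - 1)) + w)).
Proof.
move=> phis phib jv jw E.
pose N := (\max_(i <- s) absz (i - j)%R).+1.
have sN i : i \in s -> `|i - j| < N%:Z.
  move=> si; rewrite /N -abszE ltz_nat ltnS.
  exact: (@leq_bigmax_seq _ s xpredT (fun k : int => absz (k - j)%R)).
pose u := shifted_mean j phi.
have mean i d : i != j -> d != 0 -> has_mean (nu j) (bond_term g d phi i)
    (e_ j i * (u (i + d) - u i)) by exact: has_mean_bond_term phis phib j i d.
have uE i : N%:Z <= `|i - j| -> u i = E.
  by move=> iN; apply: shifted_mean_outside phis _ _ _; apply/negP => /sN; lia.
have right k : has_mean (nu j)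
    (fun x => p * bond_term g 1 phi (j + 1 + k%:Z) x
              + (1 - p) * bond_term g (-1) phi (j + 1 + k%:Z) x)
    (p * (es * (u (j + 1 + k.+1%:Z) - u (j + 1 + k%:Z)))
     + (1 - p) * (es * (u (j + k%:Z) - u (j + k.+1%:Z)))).
  have jk : j + 1 + k%:Z != j by lia.
  have -> : es = e_ j (j + 1 + k%:Z) by rewrite /e_ ifF //; lia.
  have -> : u (j + k.+1%:Z) = u (j + 1 + k%:Z) by congr u; lia.
  have -> : u (j + 1 + k.+1%:Z) = u (j + 1 + k%:Z + 1) by congr u; lia.
  have -> : u (j + k%:Z) = u (j + 1 + k%:Z - 1) by congr u; lia.
  by apply: has_meanD; apply: has_meanZ; apply: mean.
have left k : has_mean (nu j)
    (fun x => p * bond_term g 1 phi (j - 1 - k%:Z) x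
              + (1 - p) * bond_term g (-1) phi (j - 1 - k%:Z) x)
    (p * (et * (u (j - k%:Z) - u (j - k.+1%:Z)))
     + (1 - p) * (et * (u (j - 1 - k.+1%:Z) - u (j - 1 - k%:Z)))).
  have jk : j - 1 - k%:Z != j by lia.
  have -> : et = e_ j (j - 1 - k%:Z) by rewrite /e_ ifT //; lia.
  have -> : u (j - k.+1%:Z) = u (j - 1 - k%:Z) by congr u; lia.
  have -> : u (j - 1 - k.+1%:Z) = u (j - 1 - k%:Z - 1) by congr u; lia.
  have -> : u (j - k%:Z) = u (j - 1 - k%:Z + 1) by congr u; lia.
  by apply: has_meanD; apply: has_meanZ; apply: mean.
have all := has_meanD (has_meanD (has_mean_sum N right) (has_mean_sum N left))
  (has_meanD (has_meanZ p jv) (has_meanZ (1 - p) jw)).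
apply: has_mean_ext.
  by move=> x; rewrite (generator_window p g x phis sN); reflexivity.
move: all; congr (has_mean _ _ _).
have tel (f : nat -> R) : \sum_(k < N) (f k.+1 - f k) = f N - f 0%N.
  by rewrite -(big_mkord xpredT (fun k => f k.+1 - f k)) telescope_sumr.
have telN (f : nat -> R) : \sum_(k < N) (f k - f k.+1) = f 0%N - f N.
  by rewrite -opprB -tel -sumrN; apply: eq_bigr => k _; rewrite opprB.
rewrite !big_split /= -!mulr_sumr.
rewrite (tel (fun k => u (j + 1 + k%:Z))) (telN (fun k => u (j + k%:Z))).
rewrite (telN (fun k => u (j - k%:Z))) (tel (fun k => u (j - 1 - k%:Z))).
rewrite (uE (j + 1 + N%:Z)) ?(uE (j + N%:Z)) ?(uE (j - N%:Z))
  ?(uE (j - 1 - N%:Z)); try lia.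
have -> : j - 0%:Z = j by lia.
have -> : j - 1 - 0%:Z = j - 1 by lia.
by rewrite !addr0 /u; ring.
Qed.

End shock_mean.

(** * Second class particle on a stationary background *)

Section stationary_shock.
Context {R : realType}.
Variables (g : int -> R) (mt ms : int -> R) (et es r c : R)
  (nu : int -> probability pair_space R).
Hypothesis hnu : forall j, is_product_measure (nu j) (marginals mt ms ms j).
Hypotheses (mt0 : forall z, 0 <= mt z) (ms0 : forall z, 0 <= ms z).
Hypotheses (gmt : forall y, g y * mt y = et * mt (y - 1))
  (gms : forall y, g y * ms y = es * ms (y - 1)).
Hypothesis grec : forall y, ms y != 0 -> g (y + 1) = r * g y + c.

Let m0 := marginals_ge0 mt0 ms0 ms0.

Section one_function.
Variables (s : seq int) (phi : pair_config -> R).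
Hypotheses (phis : depends_on s phi) (phib : bounded_function phi).

Lemma has_mean_site_rate j : has_mean (nu j) (fun x => g (x j).1 * phi x)
  (es * shifted_mean nu j phi j).
Proof.
apply: (@has_mean_rate _ _ (marginals mt ms ms j) s j (fun a => g a.1)) => //.
  move=> a; rewrite /marginals ltxx eqxx /one_discrepancy /shift_pair /=.
  by rewrite addrAC (inj_eq (addIr _)); case: ifP; rewrite ?mulr0.
exact (has_mean_shifted nu phis phib j j).
Qed.

(** Almost surely [zeta] exceeds [omega] by 1 at [j], so the recursion turns the gap of rates into
    [(r - 1) * g + c]. *)
Lemma has_mean_site_gap j :
  has_mean (nu j) (fun x => (g (x j).2 - g (x j).1) * phi x)
    ((r - 1) * (es * shifted_mean nu j phi j)
     + c * Rintegral (nu j) setT phi).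
Proof.
have mean := has_meanD (has_meanZ (r - 1) (has_mean_site_rate j))
  (has_meanZ c (has_mean_function nu phis phib j)).
pose s' := j :: s.
have phis' : depends_on s' phi.
  by apply: depends_on_sub phis => k ks; rewrite inE ks orbT.
have js' : j \in s' by rewrite mem_head.
apply: (@has_mean_ae _ _ (marginals mt ms ms j) s' j) mean => //.
- apply: (depends_on2 *%R) => //.
  exact: (depends_on_site (fun a => g a.2 - g a.1)).
- apply: (depends_on2 +%R); apply: (depends_on2 *%R) => //.
  by apply: (depends_on2 *%R) => //; exact: (depends_on_site (fun a => g a.1)).
move=> x; rewrite /marginals ltxx eqxx /one_discrepancy.
case: ifP => [/eqP -> /grec ->|_]; last by rewrite eqxx.
by ring.
Qed.

Lemma has_mean_site_both j d : d != 0 ->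
  has_mean (nu j) (fun x => g (x j).1 * (phi (move_both j (j + d) x) - phi x))
    (es * (shifted_mean nu j phi (j + d) - shifted_mean nu j phi j)).
Proof.
move=> d0; have jd : j != j + d by rewrite -{1}[j]addr0 (inj_eq (addrI _)) eq_sym.
apply: (@has_mean_rate _ _ (marginals mt ms ms j) s j (fun a => g a.1)) => //.
- move=> a; rewrite /marginals ltxx eqxx /one_discrepancy /shift_pair /=.
  by rewrite addrAC (inj_eq (addIr _)); case: ifP; rewrite ?mulr0.
- by apply: (depends_on2 (fun a b => a - b)) => //; exact: depends_on_move_both.
apply: has_mean_ext (has_meanB (has_mean_shifted nu phis phib j (j + d))
  (has_mean_shifted nu phis phib j j)).
by move=> x; rewrite move_both_shift_at.
Qed.

(** The hypothesis on [kappa] says that the gap rate times the masses at [j] and [j + d] is [kappa]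
    times the masses after the jump. The gain term of the second class particle is therefore a
    multiple of the mean under [nu (j + d)]. *)
Lemma has_mean_site j d kappa : d = 1 \/ d = -1 ->
  (forall y z, (g (y + 1) - g y) * (ms y * (if d == 1 then ms z else mt z)) =
     kappa * ((if d == 1 then mt y else ms y) * ms z)) ->
  has_mean (nu j) (bond_term g d phi j)
    (es * (shifted_mean nu j phi (j + d) - shifted_mean nu j phi j)
     + (kappa * Rintegral (nu (j + d)) setT phi
        - ((r - 1) * (es * shifted_mean nu j phi j)
           + c * Rintegral (nu j) setT phi))).
Proof.
move=> d1 hk; have d0 : d != 0 by case: d1 => ->.
have jd : j != j + d by rewrite -{1}[j]addr0 (inj_eq (addrI _)) eq_sym.
have second : has_mean (nu j)
    (fun x => (g (x j).2 - g (x j).1) * phi (move_second j (j + d) x))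
    (kappa * Rintegral (nu (j + d)) setT phi).
  apply: (@has_mean_move_second _ _ (nu (j + d)) (marginals mt ms ms j)
    (marginals mt ms ms (j + d)) s j (j + d) (fun a => g a.2 - g a.1)) => //.
  - move=> l lj ld; apply: marginals_neq => //.
    by move: lj ld; case: d1 => ->; lia.
  - move=> [a a'] [b b'] /=; rewrite !marginalsE !ltxx !eqxx /one_discrepancy /=.
    rewrite (negbTE jd) [j + d == j]eq_sym (negbTE jd) /Defs.diagonal /=.
    have [->|aa'] := eqVneq a' (a + 1); last first.
      have aa1 : (a == a' - 1) = false by apply: contraNF aa' => /eqP ->; rewrite subrK.
      by rewrite aa1 if_same !(mul0r, mulr0).
    rewrite addrK eqxx (inj_eq (addIr _)) [b' == b]eq_sym.
    have [->|bb'] := eqVneq b b'; last by rewrite if_same !mulr0.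
    by have := hk a b'; case: d1 => ->; rewrite /= ?ltrDl ?gtrDl /=.
  - exact (has_mean_function nu phis phib (j + d)).
apply: has_mean_ext (has_meanD (has_mean_site_both j d0)
  (has_meanB second (has_mean_site_gap j))).
by move=> x; rewrite /bond_term; ring.
Qed.

End one_function.

(** For [p = 1] the leftward bond at [j] has coefficient 0, so the existence of its mean is
    enough. *)
Lemma has_mean_site_ex s phi j d : depends_on s phi -> bounded_function phi ->
  d != 0 -> exists w, has_mean (nu j) (bond_term g d phi j) w.
Proof.
move=> phis phib d0; eexists; apply: has_meanD.
  exact (has_mean_site_both phis phib j d0).
apply: (@has_mean_site_gap s).
  by apply: (depends_on2 (fun a b => a - b)) => //; exact: depends_on_move_second.
case: phib => M phiM; exists (M + M) => x.
by rewrite (le_trans (ler_normB _ _)) // lerD.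
Qed.

Lemma generator_cst p k x : generator p g (fun=> k) x = 0.
Proof. by rewrite /generator fsbig1 // => i _; rewrite subrr !mulr0 !addr0. Qed.

(* [kappa] is a ratio of partition functions; the balance for [phi = 1] computes
   it without summing any series. *)
Lemma shock_steps_right kappa :
  r * es = et -> (forall y, (g (y + 1) - g y) * ms y = kappa * mt y) ->
  c + et - es = kappa /\
  (0 <= kappa -> random_walking_shock 1 g nu kappa 0).
Proof.
move=> res hk.
have mean s phi j : depends_on s phi -> bounded_function phi ->
    has_mean (nu j) (generator 1 g phi)
      (kappa * Rintegral (nu (j + 1)) setT phi
       - (c + et - es) * Rintegral (nu j) setT phi).
  move=> phis phib.
  have [w jw] := has_mean_site_ex j phis phib (isT : (-1 : int) != 0).
  have hk' y z : (g (y + 1) - g y) * (ms y * ms z) = kappa * (mt y * ms z).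
    by rewrite mulrA hk mulrA.
  have jv := @has_mean_site s phi phis phib j 1 kappa (or_introl erefl) hk'.
  have := has_mean_generator hnu mt0 ms0 ms0 gmt gms 1 phis phib jv jw.
  (* The shifted mean at [j + 1] cancels between the right half line and the bond at [j]; the one at
     [j] cancels because [r * es = et]. *)
  by rewrite -res; congr (has_mean _ _ _); ring.
have kE : c + et - es = kappa.
  have b1 : bounded_function (fun=> 1 : R) by exists 1 => x; rewrite normr1.
  have h := mean [::] (fun=> 1) 0 (fun _ _ _ => erefl) b1.
  have h0 := has_mean_ext (fun x => esym (generator_cst 1 1 x)) (has_mean_cst (nu 0) 0).
  have := has_mean_unique h0 h.
  rewrite (has_mean_cst (nu (0 + 1)) 1).2 (has_mean_cst (nu 0) 1).2 !mulr1.
  by move=> /eqP; rewrite eq_sym subr_eq0 => /eqP.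
split=> // k0; split=> // j phi [s phis] phib.
have [iL ->] := mean s phi j phis phib; split=> //.
by rewrite kE; ring.
Qed.

(** The gap rate is the constant [a] and both sides carry the same marginal, so a jump either way
    gives [kappa = a] and all shifted means cancel. *)
Lemma shock_steps_both p a : 0 <= p <= 1 -> 0 <= a ->
  r = 1 -> c = a -> es = et -> ms = mt ->
  random_walking_shock p g nu (p * a) ((1 - p) * a).
Proof.
move=> /andP[p0 p1] a0 r1 ca eset mst.
have hk y : (g (y + 1) - g y) * ms y = a * ms y.
  have [->|/grec ->] := eqVneq (ms y) 0; first by rewrite !mulr0.
  by rewrite r1 ca mul1r addrC addKr.
split=> [||j phi [s phis] phib].
- exact: mulr_ge0.
- by rewrite mulr_ge0 // subr_ge0.
have hk' y z : (g (y + 1) - g y) * (ms y * ms z) = a * (ms y * ms z).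
  by rewrite mulrA hk mulrA.
have jv := @has_mean_site s phi phis phib j 1 a (or_introl erefl) _.
have jw := @has_mean_site s phi phis phib j (-1) a (or_intror erefl) _.
rewrite /= -mst in jv jw.
have [iL ->] := has_mean_generator hnu mt0 ms0 ms0 gmt gms p phis phib (jv hk') (jw hk').
by split=> //; rewrite r1 ca eset; ring.
Qed.

End stationary_shock.

(** * Balance equations on three sites *)

Section three_sites.
Context {R : realType}.
Implicit Types (mu : probability pair_space R) (m : int -> int * int -> R)
  (a b c : int * int) (g : int -> R).

(** Test functions that see the second class particle at 0 and both places it can jump to. *)
Definition three_sites a b c (x : pair_config) : R :=
  ((x (-1) == a) && (x 0 == b) && (x 1 == c))%:R.

Let s3 : seq int := [:: -1; 0; 1].

Lemma depends_on_three_sites a b c : depends_on s3 (three_sites a b c).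
Proof. by move=> x y e; rewrite /three_sites !e. Qed.

Lemma bounded_three_sites a b c : bounded_function (three_sites a b c).
Proof. by exists 1 => x; rewrite ger0_norm ?ler0n // /three_sites; case: (_ && _). Qed.

Lemma has_mean_three_sites mu m a b c :
  is_product_measure mu m -> (forall i a, 0 <= m i a) ->
  has_mean mu (three_sites a b c) (m (-1) a * m 0 b * m 1 c).
Proof.
move=> mum m0.
have := has_mean_bounded mu (@depends_on_three_sites a b c)
  (@bounded_three_sites a b c).
congr (has_mean _ _ _).
(* Only the values of [y] at -1, 0 and 1 matter; elsewhere [a] is a filler. *)
pose y : pair_config := fun i => if i == 0 then b else if i == 1 then c else a.
pose C := [set x : pair_config | forall i, i \in s3 -> x i = y i].
have ind (x : pair_space) : (three_sites a b c x)%:E = (\1_C x)%:E.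
  rewrite indicE /three_sites; congr (_%:R%:E); congr nat_of_bool.
  apply/idP/idP; rewrite inE /=.
    move=> /andP[/andP[/eqP xa /eqP xb] /eqP xc] i.
    by rewrite !inE => /or3P[] /eqP ->.
  by move=> xy; rewrite !xy // !eqxx.
rewrite /Rintegral; under eq_integral do rewrite ind.
rewrite integral_indic //; first last.
- exact: measurable_cylinder.
rewrite setIT.
transitivity (fine (config_mass m s3 y)%:E).
  by congr fine; exact: product_measure_cylinder.
by rewrite /config_mass !big_cons big_nil /= mulr1 mulrA.
Qed.

(** The preimage of a cylinder under a jump is again a cylinder; likewise for the other moves and
    for the shift below. *)
Lemma three_sites_move_both_right a b c x :
  three_sites a b c (move_both 0 1 x) =
  three_sites a (shift_pair 1 b) (shift_pair (-1) c) x.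
Proof.
rewrite /three_sites /move_both /move /shift_pair /=.
case: (x (-1)) (x 0) (x 1) => [u u'] [v v'] [w w'].
case: a b c => [a a'] [b b'] [c c'] /=; rewrite !xpair_eqE.
by congr (_%:R); congr nat_of_bool; lia.
Qed.

Lemma three_sites_move_both_left a b c x :
  three_sites a b c (move_both 0 (-1) x) =
  three_sites (shift_pair (-1) a) (shift_pair 1 b) c x.
Proof.
rewrite /three_sites /move_both /move /shift_pair /=.
case: (x (-1)) (x 0) (x 1) => [u u'] [v v'] [w w'].
case: a b c => [a a'] [b b'] [c c'] /=; rewrite !xpair_eqE.
by congr (_%:R); congr nat_of_bool; lia.
Qed.

Lemma three_sites_move_second_right a b c x :
  three_sites a b c (move_second 0 1 x) =
  three_sites a (b.1, b.2 + 1) (c.1, c.2 - 1) x.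
Proof.
rewrite /three_sites /move_second /move /=.
case: (x (-1)) (x 0) (x 1) => [u u'] [v v'] [w w'].
case: a b c => [a a'] [b b'] [c c'] /=; rewrite !xpair_eqE.
by congr (_%:R); congr nat_of_bool; lia.
Qed.

Lemma three_sites_move_second_left a b c x :
  three_sites a b c (move_second 0 (-1) x) =
  three_sites (a.1, a.2 - 1) (b.1, b.2 + 1) c x.
Proof.
rewrite /three_sites /move_second /move /=.
case: (x (-1)) (x 0) (x 1) => [u u'] [v v'] [w w'].
case: a b c => [a a'] [b b'] [c c'] /=; rewrite !xpair_eqE.
by congr (_%:R); congr nat_of_bool; lia.
Qed.

Lemma three_sites_shift a b c i x :
  three_sites a b c (shift_at i 1 x) =
  three_sites (if i == -1 then shift_pair (-1) a else a)
    (if i == 0 then shift_pair (-1) b else b)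
    (if i == 1 then shift_pair (-1) c else c) x.
Proof.
rewrite /three_sites /shift_at /shift_pair ![_ == i]eq_sym.
case: (x (-1)) (x 0) (x 1) => [u u'] [v v'] [w w'].
case: a b c => [a a'] [b b'] [c c'] /=.
congr (_%:R); congr nat_of_bool; congr ((_ && _) && _);
  by case: ifP => _; rewrite !xpair_eqE; lia.
Qed.

Lemma three_sites_rate (f : int * int -> R) a b c x :
  f (x 0) * three_sites a b c x = f b * three_sites a b c x.
Proof.
rewrite /three_sites; have [->//|xb] := eqVneq (x 0) b.
by rewrite andbF !mulr0.
Qed.

End three_sites.

Section necessity.
Context {R : realType}.
Variables (g : int -> R) (mt ms mh : int -> R) (et es p P Q : R)
  (nu : int -> probability pair_space R).
Hypothesis hnu : forall j, is_product_measure (nu j) (marginals mt ms mh j).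
Hypotheses (mt0 : forall z, 0 <= mt z) (ms0 : forall z, 0 <= ms z)
  (mh0 : forall z, 0 <= mh z).
Hypotheses (gmt : forall y, g y * mt y = et * mt (y - 1))
  (gms : forall y, g y * ms y = es * ms (y - 1)).
Hypothesis rws : random_walking_shock p g nu P Q.

Let m0 := marginals_ge0 mt0 ms0 mh0.

Let T a b c := Defs.diagonal mt a * one_discrepancy mh b * Defs.diagonal ms c.

(** The shock property at [j = 0], tested on [three_sites a b c]. On the indicator each rate is
    frozen at its value for the configuration before the jump, so both sides are explicit in the
    masses. *)
Lemma three_sites_balance a b c :
  p * (et * (T a (shift_pair (-1) b) c - T a b c)
       + es * (T a b c - T a b (shift_pair (-1) c))
       + (g (b.1 + 1) * T a (shift_pair 1 b) (shift_pair (-1) c)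
          - g b.1 * T a b c
          + (g (b.2 + 1) - g b.1) * T a (b.1, b.2 + 1) (c.1, c.2 - 1)
          - (g b.2 - g b.1) * T a b c))
  + (1 - p) * (es * (T a (shift_pair (-1) b) c - T a b c)
       + et * (T a b c - T (shift_pair (-1) a) b c)
       + (g (b.1 + 1) * T (shift_pair (-1) a) (shift_pair 1 b) c
          - g b.1 * T a b c
          + (g (b.2 + 1) - g b.1) * T (a.1, a.2 - 1) (b.1, b.2 + 1) c
          - (g b.2 - g b.1) * T a b c))
  = P * (Defs.diagonal mt a * Defs.diagonal mt b * one_discrepancy mh c - T a b c)
    + Q * (one_discrepancy mh a * Defs.diagonal ms b * Defs.diagonal ms c - T a b c).
Proof.
have mean j a' b' c' := has_mean_three_sites a' b' c' (hnu j) (m0 j).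
have mean0 a' b' c' : has_mean (nu 0) (three_sites a' b' c') (T a' b' c').
  by have := mean 0 a' b' c'; congr (has_mean _ _ _).
have right : has_mean (nu 0) (bond_term g 1 (three_sites a b c) 0)
    (g (b.1 + 1) * T a (shift_pair 1 b) (shift_pair (-1) c)
          - g b.1 * T a b c
          + (g (b.2 + 1) - g b.1) * T a (b.1, b.2 + 1) (c.1, c.2 - 1)
          - (g b.2 - g b.1) * T a b c).
  apply: has_mean_ext; last first.
    by apply: has_meanB; [apply: has_meanD; [apply: has_meanB|]|];
      apply: has_meanZ; exact: mean0.
  move=> x; rewrite /bond_term add0r three_sites_move_both_right
    three_sites_move_second_right !mulrBr.
  rewrite !(three_sites_rate (fun a => g a.1)).
  by rewrite !(three_sites_rate (fun a => g a.2 - g a.1)) /=; ring.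
have left : has_mean (nu 0) (bond_term g (-1) (three_sites a b c) 0)
    (g (b.1 + 1) * T (shift_pair (-1) a) (shift_pair 1 b) c
          - g b.1 * T a b c
          + (g (b.2 + 1) - g b.1) * T (a.1, a.2 - 1) (b.1, b.2 + 1) c
          - (g b.2 - g b.1) * T a b c).
  apply: has_mean_ext; last first.
    by apply: has_meanB; [apply: has_meanD; [apply: has_meanB|]|];
      apply: has_meanZ; exact: mean0.
  move=> x; rewrite /bond_term add0r three_sites_move_both_left
    three_sites_move_second_left !mulrBr.
  rewrite !(three_sites_rate (fun a => g a.1)).
  by rewrite !(three_sites_rate (fun a => g a.2 - g a.1)) /=; ring.
have dep := @depends_on_three_sites R a b c.
have bnd := @bounded_three_sites R a b c.
have [_ gen] := has_mean_generator hnu mt0 ms0 mh0 gmt gms p dep bnd right left.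
have [_ _ /(_ 0 (three_sites a b c)) [|//|_]] := rws; first by exists [:: -1; 0; 1].
rewrite gen add0r sub0r.
have shiftE i : shifted_mean nu 0 (three_sites a b c) i =
    T (if i == -1 then shift_pair (-1) a else a)
      (if i == 0 then shift_pair (-1) b else b)
      (if i == 1 then shift_pair (-1) c else c).
  rewrite -(mean0 _ _ _).2; congr Rintegral; apply/funext => x.
  exact: three_sites_shift.
by rewrite !shiftE !(mean _ _ _ _).2 !addrA.
Qed.

(** With the discrepancy put at site 1, only the jump of the second class particle from 0 to 1 and
    the term of [nu 1] survive. *)
Lemma right_jump_balance x y z :
  p * (g (y + 1) - g y) * (mt x * (mh y * ms z)) = P * (mt x * (mt y * mh z)).
Proof.
have := three_sites_balance (x, x) (y, y) (z, z + 1).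
rewrite /T /Defs.diagonal /one_discrepancy /shift_pair /= addrK.
by do !(case: eqP => ?; try lia); lra.
Qed.

Lemma left_jump_balance x y z :
  (1 - p) * (g (y + 1) - g y) * (mt x * (mh y * ms z)) = Q * (mh x * (ms y * ms z)).
Proof.
have := three_sites_balance (x, x + 1) (y, y) (z, z).
rewrite /T /Defs.diagonal /one_discrepancy /shift_pair /= addrK.
by do !(case: eqP => ?; try lia); lra.
Qed.

(** With the discrepancy at 0, the measures [nu 1] and [nu (-1)] give no mass and the right side is
    pure loss. *)
Lemma central_balance x y z :
  p * (et * (mt x * ((mh (y - 1) - mh y) * ms z))
       + es * (mt x * (mh y * (ms z - ms (z - 1))))
       + mt x * (g (y + 1) * mh (y + 1) * ms (z - 1) - g (y + 1) * mh y * ms z))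
  + (1 - p) * (es * (mt x * ((mh (y - 1) - mh y) * ms z))
       + et * ((mt x - mt (x - 1)) * (mh y * ms z))
       + (g (y + 1) * mh (y + 1) * mt (x - 1) - g (y + 1) * mh y * mt x) * ms z)
  = - (P + Q) * (mt x * (mh y * ms z)).
Proof.
have := three_sites_balance (x, x) (y, y + 1) (z, z).
rewrite /T /Defs.diagonal /one_discrepancy /shift_pair /=.
by do !(case: eqP => ?; try lia); lra.
Qed.

End necessity.

(** * Stationary marginals *)

Lemma occ0 I : occ I 0.
Proof. by case: I. Qed.

Lemma occS I y : occ I y -> occ I (y + 1).
Proof. by case: I => //= y0; lia. Qed.

Section recursions.
Context {R : realType}.
Implicit Types (I : occupation_range) (g f m h : int -> R).

(** Induction from 0 in both directions, the downward one being asked for only when the range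
    contains negative numbers. *)
Lemma occ_ind I (p : int -> Prop) : p 0 ->
  (forall y, occ I y -> p y -> p (y + 1)) ->
  (I = AllInts -> forall y, p (y + 1) -> p y) ->
  forall y, occ I y -> p y.
Proof.
move=> p0 up down [n|n].
  elim: n => [|n IHn] // _; rewrite -addn1 PoszD.
  have on : occ I n by case: (I).
  by apply: up => //; exact: IHn.
move=> on; have IA : I = AllInts by move: on; case: (I).
rewrite NegzE; elim: n {on} => [|n IHn].
  by apply: (down IA).
by apply: (down IA); rewrite (_ : _ + 1 = - n.+1%:Z) //; lia.
Qed.

Lemma expR_mulz_succ (b : R) (y : int) :
  expR (b * (y + 1)%:~R) = expR b * expR (b * y%:~R).
Proof. by rewrite -expRD rmorphD; congr expR; rewrite /=; ring. Qed.

Lemma geometric_solution I b h :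
  (forall y, occ I y -> h (y + 1) = expR b * h y) ->
  forall y, occ I y -> h y = h 0 * expR (b * y%:~R).
Proof.
move=> rec; apply: occ_ind => [|y oy|IA y] //.
- by rewrite mulr0 expR0 mulr1.
- by move=> e; rewrite rec // e expR_mulz_succ; ring.
rewrite rec; last by rewrite IA.
rewrite expR_mulz_succ => e.
apply: (mulfI (lt0r_neq0 (expR_gt0 b))); rewrite e; ring.
Qed.

Lemma affine_solution I b c g : b != 0 ->
  (forall y, occ I y -> g (y + 1) = expR b * g y + c) ->
  let k := c / (1 - expR b) in
  forall y, occ I y -> g y = (g 0 - k) * expR (b * y%:~R) + k.
Proof.
move=> b0 rec k y oy; have rb : 1 - expR b != 0.
  rewrite subr_eq0 -expR0; apply: contra_neq b0 => e.
  by apply: expR_inj; rewrite -e expR0.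
(* [k] is the fixed point of the affine map, so [g - k] is geometric. *)
rewrite -(@geometric_solution I b (fun y => g y - k)) ?subrK // => z oz.
by rewrite rec // /k; field.
Qed.

Lemma linear_solution I c g :
  (forall y, occ I y -> g (y + 1) = g y + c) ->
  forall y, occ I y -> g y = g 0 + c * y%:~R.
Proof.
move=> rec; apply: occ_ind => [|y oy|IA y] //.
- by rewrite mulr0 addr0.
- by move=> e; rewrite rec // e rmorphD /=; ring.
rewrite rec; last by rewrite IA.
by rewrite rmorphD /= => e; apply: (addIr c); rewrite e; ring.
Qed.

Lemma admissible_succ_gt0 I g y : admissible I g -> occ I y -> 0 < g (y + 1).
Proof.
by case: I => -[_ _ _] //= [_ g0] y0; apply: g0; lia.
Qed.

(** Both functions solve the same first order recursion, which the value at 0 determines: upwards by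
    division by [g (y + 1)], downwards by division by [e]. *)
Lemma recursion_proportional I g e f m : admissible I g -> e != 0 -> m 0 != 0 ->
  (forall y, ~ occ I y -> f y = 0) -> (forall y, ~ occ I y -> m y = 0) ->
  (forall y, occ I y -> g (y + 1) * f (y + 1) = e * f y) ->
  (forall y, occ I y -> g (y + 1) * m (y + 1) = e * m y) ->
  forall y, f y = f 0 / m 0 * m y.
Proof.
move=> adm e0 m0 fout mout frec mrec y.
have [oy|noy] := pselect (occ I y); last by rewrite (fout _ noy) (mout _ noy) mulr0.
move: y oy; apply: occ_ind => [|y oy IHy|IA y].
- by rewrite divfK.
- apply: (mulfI (lt0r_neq0 (admissible_succ_gt0 adm oy))).
  by rewrite frec // IHy mulrCA [in RHS]mulrCA mrec.
have oy : occ I y by rewrite IA.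
move=> IHy; apply: (mulfI e0); rewrite -frec // IHy mulrCA mrec //; ring.
Qed.

End recursions.

Section stationary.
Context {R : realType}.
Variables (I : occupation_range) (g : int -> R).
Hypothesis adm : admissible I g.

Lemma gfact_gt0 z : occ I z -> 0 < gfact g z.
Proof.
case: z => [n _|n on] /=.
  rewrite big_add1 /= big_mkord; apply: prodr_gt0 => k _.
  by rewrite -addn1 PoszD; apply: admissible_succ_gt0 adm _; case: (I).
have IA : I = AllInts by move: on; case: (I).
rewrite invr_gt0; apply: prodr_gt0 => k _.
by move: adm; rewrite IA => -[].
Qed.

Lemma gfactS y : occ I y -> gfact g (y + 1) = g (y + 1) * gfact g y.
Proof.
case: y => [n _|n on].
  by rewrite -PoszD addn1 /= big_nat_recr //= mulrC.
have IA : I = AllInts by move: on; case: (I).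
have g0 z : 0 < g z by move: adm; rewrite IA => -[].
case: n {on} => [|n].
  have -> : Negz 0 + 1 = 0 by lia.
  by rewrite /= big_geq // big_nat1 oppr0 divff // lt0r_neq0.
have -> : Negz n.+1 + 1 = Negz n by lia.
have -> : Negz n = - n.+1%:Z by lia.
rewrite -[X in gfact g X = _]/(Negz n) /= [in RHS]big_nat_recr //= invfM mulrCA.
by rewrite mulfV ?mulr1 // lt0r_neq0.
Qed.

Variable theta : R.
Notation mu := (stationary_marginal I g theta).

Lemma stationary_out z : ~ occ I z -> mu z = 0.
Proof. by move=> nz; rewrite /stationary_marginal ifF //; apply/negP; rewrite inE. Qed.

Lemma weight_gt0 z : occ I z -> 0 < weight g theta z.
Proof. by move=> oz; rewrite divr_gt0 ?expR_gt0 ?gfact_gt0. Qed.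

Let Z := fine (partition_function I g theta).

Let Z_ge0 : 0 <= Z.
Proof.
apply/fine_ge0/esum_ge0 => z oz.
by rewrite lee_fin ltW // weight_gt0.
Qed.

Lemma stationary_ge0 z : 0 <= mu z.
Proof.
rewrite /stationary_marginal; case: ifP => // /[!inE] oz.
by rewrite divr_ge0 // ltW // weight_gt0.
Qed.

Lemma stationary_succ y : occ I y -> g (y + 1) * mu (y + 1) = expR theta * mu y.
Proof.
move=> oy; have oy1 := occS oy.
rewrite /stationary_marginal !mem_set // !mulrA; congr (_ / _).
rewrite /weight gfactS // rmorphD /= mulrDr mulr1 expRD.
have g1 := lt0r_neq0 (admissible_succ_gt0 adm oy).
have f1 := lt0r_neq0 (gfact_gt0 oy).
by field; rewrite ?f1 ?g1.
Qed.

(** At the left end of the range [g 0 = 0] matches the mass 0 outside, so the identity holds for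
    every integer. *)
Lemma stationary_rate y : g y * mu y = expR theta * mu (y - 1).
Proof.
have [oy|noy] := pselect (occ I (y - 1)).
  by rewrite -stationary_succ // subrK.
rewrite (stationary_out noy) mulr0.
have [oy'|noy'] := pselect (occ I y); last by rewrite stationary_out // mulr0.
move: adm oy' noy; case: (I) => //= -[_ _ _ [g0 _]] y0 ny.
have -> : y = 0 by lia.
by rewrite g0 mul0r.
Qed.

(** A divergent partition function has [fine] value 0, and division by 0 would make every mass 0;
    one nonzero mass excludes this. *)
Lemma stationary_gt0 z : (exists y, mu y != 0) -> occ I z -> 0 < mu z.
Proof.
move=> [y]; rewrite /stationary_marginal => mu0 oz; rewrite mem_set //.
rewrite divr_gt0 ?weight_gt0 // lt_neqAle Z_ge0 andbT eq_sym.
apply: contraNneq mu0 => Z0; case: ifP => // _.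
by rewrite Z0 invr0 mulr0.
Qed.

End stationary.

(** * Total mass and nonvanishing marginals *)

Section normalisation.
Context {R : realType}.
Variables (mt ms mh : int -> R) (nu : int -> probability pair_space R).
Hypothesis hnu : forall j, is_product_measure (nu j) (marginals mt ms mh j).
Hypotheses (mt0 : forall z, 0 <= mt z) (ms0 : forall z, 0 <= ms z)
  (mh0 : forall z, 0 <= mh z).

(** If the marginal at [i] vanished identically, the constant 1 would have mean 0. At site 0 under
    [nu 1] and [nu (-1)] this shows that the left and right masses do not vanish identically. *)
Lemma product_measure_nonzero (mu : probability pair_space R) m i :
  is_product_measure mu m -> (forall i a, 0 <= m i a) -> exists a, m i a != 0.
Proof.
move=> mum m0; apply/not_existsP => mz.
have : has_mean mu (fun=> 1) 0.
  apply: (@has_mean_ae _ _ m [::] i _ (fun=> 0)) (has_mean_cst mu 0) => //.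
  by move=> x /mz.
move=> /(has_mean_unique (has_mean_cst mu 1))/eqP.
by rewrite oner_eq0.
Qed.

Lemma left_marginal_nonzero : exists y, mt y != 0.
Proof.
have [a] := product_measure_nonzero 0 (hnu 1) (marginals_ge0 mt0 ms0 mh0 1).
by rewrite marginalsE /= /Defs.diagonal; case: ifP => [_|]; [exists a.1|rewrite eqxx].
Qed.

Lemma right_marginal_nonzero : exists y, ms y != 0.
Proof.
have [a] := product_measure_nonzero 0 (hnu (-1)) (marginals_ge0 mt0 ms0 mh0 (-1)).
by rewrite marginalsE /= /Defs.diagonal; case: ifP => [_|]; [exists a.1|rewrite eqxx].
Qed.

(* At site [0], moving [zeta] by one maps [ms] under [nu (-1)] to [mh] under
   [nu 0], so [k] is a ratio of total masses. *)
Lemma proportional_marginals k : (forall y, mh y = k * ms y) -> mh = ms.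
Proof.
move=> hk; suff k1 : k = 1 by apply/funext => y; rewrite hk k1 mul1r.
pose t d (x : pair_config) : pair_config :=
  fun i => if i == 0 then ((x i).1, (x i).2 + d) else x i.
have tK d : cancel (t d) (t (- d)).
  move=> x; apply/funext => i; rewrite /t; case: eqP => // _.
  by rewrite addrK; case: (x i).
have tN d : cancel (t (- d)) (t d) by move=> x; rewrite -{1}(opprK d) tK.
have out d x i : i \notin [:: 0 : int] -> t d x i = x i.
  by rewrite inE /t => /negbTE ->.
apply: (@has_mean_unique _ (nu (-1)) (fun=> k)); first exact: has_mean_cst.
apply: (@has_mean_change _ _ _ _ _ [:: 0] (t 1) (t (- 1)) (hnu (-1)) (hnu 0)
  (marginals_ge0 mt0 ms0 mh0 (-1)) (marginals_ge0 mt0 ms0 mh0 0) isT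
  (tK 1) (tN 1) (out 1) (out (- 1)) _
  (fun=> 1)) (has_mean_cst (nu 0) 1) => //.
move=> x; rewrite /config_mass !big_seq1 !marginalsE /= /t /=.
rewrite /Defs.diagonal /one_discrepancy /= (inj_eq (addIr _)) [_ == (x 0).1]eq_sym.
by case: ifP => _; rewrite ?mulr0 // hk mul1r.
Qed.

End normalisation.

(** * Sufficiency and classification *)

Section sufficiency.
Context {R : realType}.
Variables (I : occupation_range) (g : int -> R) (theta sigma : R)
  (nu : int -> probability pair_space R).
Hypothesis adm : admissible I g.
Notation mt := (stationary_marginal I g theta).
Notation ms := (stationary_marginal I g sigma).
Hypothesis hnu : forall j, is_product_measure (nu j) (marginals mt ms ms j).

Let mt0 := stationary_ge0 adm theta.
Let ms0 := stationary_ge0 adm sigma.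
Let gmt := stationary_rate adm theta.
Let gms := stationary_rate adm sigma.

Let support y : ms y != 0 -> occ I y.
Proof.
by move=> msy; apply: contrapT => ny; move: msy; rewrite stationary_out ?eqxx.
Qed.

Lemma shock_sufficient_both p a : 0 <= p <= 1 -> 0 <= a -> theta = sigma ->
  (forall y, occ I y -> g (y + 1) = g y + a) ->
  random_walking_shock p g nu (p * a) ((1 - p) * a).
Proof.
move=> p01 a0 ts rec.
apply: (shock_steps_both hnu mt0 ms0 gmt gms (r := 1) (c := a)) => //.
- by move=> y /support /rec; rewrite mul1r.
- by rewrite ts.
- by rewrite ts.
Qed.

(** By the affine recursion [(g (y + 1) - g y) * ms y] obeys the recursion of [mt], hence is
    [kappa * mt y]; this [kappa] is then identified as [P]. *)
Lemma shock_sufficient_right c : 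
  (forall y, occ I y -> g (y + 1) = expR (theta - sigma) * g y + c) ->
  let P := c + expR theta - expR sigma in
  0 <= P -> random_walking_shock 1 g nu P 0.
Proof.
move=> rec P P0; have mt00 : mt 0 != 0.
  apply/lt0r_neq0/(stationary_gt0 adm _ (occ0 I)).
  exact: left_marginal_nonzero hnu mt0 ms0 ms0.
have rE : expR (theta - sigma) * expR sigma = expR theta.
  by rewrite -expRD subrK.
have prop := @recursion_proportional _ I g (expR theta)
  (fun y => (g (y + 1) - g y) * ms y) mt adm (lt0r_neq0 (expR_gt0 _)) mt00 _
  (@stationary_out _ I g theta) _ (stationary_succ adm theta).
have [] := shock_steps_right hnu mt0 ms0 gmt gms (r := expR (theta - sigma))
  (c := c) (fun y msy => rec y (support msy)) rE (prop _ _).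
- by move=> y /(@stationary_out _ I g sigma) ->; rewrite mulr0.
- move=> y oy /=; rewrite mulrCA stationary_succ // -rE.
  by rewrite (rec (y + 1)) ?rec //; [ring|exact: occS].
by move=> <-; apply.
Qed.

End sufficiency.

(** * Necessity: solving the balance equations *)

Section classification.
Context {R : realType}.
Variables (I : occupation_range) (g : int -> R) (theta sigma p P Q : R)
  (mh : int -> R) (nu : int -> probability pair_space R).
Hypotheses (adm : admissible I g) (hp : 0 < p <= 1) (hmh : mass_function I mh).
Notation mt := (stationary_marginal I g theta).
Notation ms := (stationary_marginal I g sigma).
Hypothesis hnu : forall j, is_product_measure (nu j) (marginals mt ms mh j).
Hypothesis rws : random_walking_shock p g nu P Q.

Let mt0 := stationary_ge0 adm theta.
Let ms0 := stationary_ge0 adm sigma.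
Let mh0 z : 0 <= mh z. Proof. by case: hmh. Qed.
Let gmt := stationary_rate adm theta.
Let gms := stationary_rate adm sigma.
Let mt_gt0 z : occ I z -> 0 < mt z.
Proof. exact/(stationary_gt0 adm)/(left_marginal_nonzero hnu). Qed.
Let ms_gt0 z : occ I z -> 0 < ms z.
Proof. exact/(stationary_gt0 adm)/(right_marginal_nonzero hnu). Qed.
Let et_gt0 : 0 < expR theta := expR_gt0 theta.
Let es_gt0 : 0 < expR sigma := expR_gt0 sigma.

(** After division by [mt x * ms z] the outer sites enter only through [g x] and [g z], each
    linearly. As [g] is not constant, varying them separates the coefficients. *)
Let central x y z : occ I x -> occ I y -> occ I z ->
  p * (expR theta * (mh (y - 1) - mh y) + expR sigma * mh y - g (y + 1) * mh y
       + g z * (g (y + 1) * mh (y + 1) / expR sigma - mh y))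
  + (1 - p) * (expR sigma * (mh (y - 1) - mh y) + expR theta * mh y
       - g (y + 1) * mh y
       + g x * (g (y + 1) * mh (y + 1) / expR theta - mh y))
  = - (P + Q) * mh y.
Proof.
move=> ox oy oz.
have := central_balance hnu mt0 ms0 mh0 gmt gms rws x y z.
have -> : mt (x - 1) = g x * mt x / expR theta.
  by rewrite gmt mulrC mulKf // lt0r_neq0.
have -> : ms (z - 1) = g z * ms z / expR sigma.
  by rewrite gms mulrC mulKf // lt0r_neq0.
move=> e; apply: (mulfI (lt0r_neq0 (mulr_gt0 (mt_gt0 ox) (ms_gt0 oz)))).
have tn := lt0r_neq0 et_gt0; have sn := lt0r_neq0 es_gt0.
transitivity (- (P + Q) * (mt x * (mh y * ms z))); last by ring.
by rewrite -e; field; rewrite ?tn ?sn.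
Qed.

Let nonconstant : exists y z, [/\ occ I y, occ I z & g y <> g z].
Proof. by case: adm. Qed.

(** Subtracting two instances of [central] with different [g z] isolates the coefficient of [g z],
    which must vanish since [0 < p]. *)
Let mh_succ y : occ I y -> g (y + 1) * mh (y + 1) = expR sigma * mh y.
Proof.
move=> oy; have [z [z' [oz oz' gz]]] := nonconstant.
have [p0 _] := andP hp.
have : p * (g z - g z') * (g (y + 1) * mh (y + 1) / expR sigma - mh y) = 0.
  by have := central oz oy oz; rewrite -(central oz oy oz'); lra.
move=> /eqP; rewrite !mulf_eq0 (gt_eqF p0) subr_eq0 => /orP[/eqP//|].
by rewrite subr_eq0 => /eqP <-; field; exact: lt0r_neq0.
Qed.

Lemma muhat_stationary : mh = ms.
Proof.
apply: (proportional_marginals hnu mt0 ms0 mh0 (k := mh 0 / ms 0)).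
apply: (recursion_proportional adm (lt0r_neq0 es_gt0)).
- exact/lt0r_neq0/ms_gt0/occ0.
- by case: hmh.
- exact: stationary_out.
- exact: mh_succ.
- exact: stationary_succ.
Qed.

(** The coefficient of [g x] in [central] must vanish as well; once [muhat] is known it is [1 - p]
    times a quantity that is zero only for equal parameters. *)
Lemma asymmetric_or_equal : p = 1 \/ theta = sigma.
Proof.
have [->|p1] := eqVneq p 1; [by left|right].
have [z [z' [oz oz' gz]]] := nonconstant.
have o0 := occ0 I.
have : (1 - p) * (g z - g z') * (g (0 + 1) * mh (0 + 1) / expR theta - mh 0) = 0.
  by have := central oz o0 oz; rewrite -(central oz' o0 oz); lra.
move=> /eqP; rewrite !mulf_eq0 !subr_eq0 eq_sym (negbTE p1) => /orP[/eqP//|].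
rewrite mh_succ // muhat_stationary => /eqP e.
apply: expR_inj; apply: (mulIf (lt0r_neq0 (ms_gt0 o0))).
by rewrite -{1}e; field; rewrite lt0r_neq0.
Qed.

Lemma rate_recursion y : occ I y ->
  g (y + 1) = expR (theta - sigma) * g y + (P + Q + expR sigma - expR theta).
Proof.
move=> oy; have o0 := occ0 I; have tn := lt0r_neq0 et_gt0.
have sn := lt0r_neq0 es_gt0; have my := lt0r_neq0 (ms_gt0 oy).
have := central o0 oy o0; rewrite mh_succ // muhat_stationary.
have -> : ms (y - 1) = g y * ms y / expR sigma.
  by rewrite gms mulrC mulKf // lt0r_neq0.
move=> e; apply: (mulfI my); rewrite expRD expRN.
have [p1|ts] := asymmetric_or_equal.
  (* The cancelling pair exposes the right side of [e], so that it can be replaced by the left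
     side. *)
  have -> : ms y * g (y + 1) = g (y + 1) * ms y + (- (P + Q) * ms y + (P + Q) * ms y).
    by ring.
  by rewrite -{1}e p1; field; rewrite sn tn.
have -> : ms y * g (y + 1) = g (y + 1) * ms y + (- (P + Q) * ms y + (P + Q) * ms y).
  by ring.
by rewrite -{1}e ts; field; rewrite ?sn ?tn.
Qed.

Lemma right_jump y : occ I y -> p * (g (y + 1) - g y) * ms y = P * mt y.
Proof.
move=> oy; have o0 := occ0 I.
have := right_jump_balance hnu mt0 ms0 mh0 gmt gms rws 0 y 0.
rewrite muhat_stationary => e.
apply: (mulfI (lt0r_neq0 (mulr_gt0 (mt_gt0 o0) (ms_gt0 o0)))).
transitivity (P * (mt 0 * (mt y * ms 0))); last by ring.
by rewrite -e; ring.
Qed.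

Lemma left_jump0 : p = 1 -> Q = 0.
Proof.
move=> p1; have o0 := occ0 I.
have := left_jump_balance hnu mt0 ms0 mh0 gmt gms rws 0 0 0.
rewrite muhat_stationary p1 subrr !mul0r => /esym/eqP.
by rewrite !mulf_eq0 !(gt_eqF (ms_gt0 o0)) !orbF => /eqP.
Qed.

(** The recursion has slope 1, so [g] is linear with increment [P + Q], and the jump at 0 splits
    this increment into [P] and [Q]. On all integers a nonconstant linear [g] would stop being
    positive far to the left. *)
Lemma shock_linear : theta = sigma ->
  exists a : R, [/\ I = NonNegInts,
    0 < a /\ (forall y : int, occ I y -> g y = a * y%:~R)
    & P = p * a /\ Q = (1 - p) * a].
Proof.
move=> ts; pose a := P + Q; have o0 := occ0 I; have [p0 _] := andP hp.
have rec y : occ I y -> g (y + 1) = g y + a.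
  by move=> /rate_recursion ->; rewrite ts subrr expR0 mul1r addrK.
have sol := linear_solution rec.
have PE : P = p * a.
  apply: (mulIf (lt0r_neq0 (ms_gt0 o0))); have := right_jump o0.
  by rewrite rec // addrC addKr ts.
have a_ge0 : 0 <= a.
  have [_ mono _ _] := adm.
  by have := mono 0 (0 + 1) o0 (occS o0) isT; rewrite rec // lerDl.
have a0 : 0 < a.
  rewrite lt_neqAle a_ge0 andbT eq_sym; apply/eqP => a0.
  have [y [z [oy oz]]] := nonconstant; apply.
  by rewrite (sol y) // (sol z) // a0 !mul0r.
have IN : I = NonNegInts.
  move: adm sol; case: (I) => // -[_ _ _ gpos] sol'.
  have [n gn] : exists n : nat, g 0 / a < n%:R.
    by exists (Num.bound (g 0 / a)); rewrite archi_boundP // divr_ge0 // ltW // gpos.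
  have := gpos (- n%:Z); rewrite sol' // mulrNz mulrN ltNge subr_le0.
  by move: gn; rewrite ltr_pdivrMr // mulrC => /ltW ->.
exists a; split=> //; last by split=> //; rewrite mulrBl -PE mul1r /a; ring.
split=> // y oy; rewrite sol //.
by move: adm; rewrite IN => -[_ _ _ [-> _]]; rewrite add0r.
Qed.

Lemma right_rate_gt0 : g 0 < g 1 -> 0 < P.
Proof.
move=> g01; have [p0 _] := andP hp; have o0 := occ0 I.
have := right_jump o0; rewrite add0r => e.
rewrite -(pmulr_lgt0 _ (mt_gt0 o0)) -e mulr_gt0 ?ms_gt0 // mulr_gt0 // subr_gt0 //.
Qed.

(** Since [g 0 = 0], the affine solution is [k * (1 - expR (b * y))] with [b = theta - sigma].
    Positivity of [g 1] gives [k] the sign opposite to [b], and the two signs are the two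
    families. *)
Lemma shock_exponential_NonNegInts : theta <> sigma -> I = NonNegInts ->
  p = 1 /\ Q = 0 /\
  ((exists a beta : R,
     [/\ 0 < beta, 0 < a,
       forall y : int, occ I y -> g y = a * (1 - expR (- beta * y%:~R)),
       theta + beta = sigma /\ sigma < ln a
     & P = (1 - expR (- beta)) * (a - expR sigma)]) \/
   (exists a beta : R,
     [/\ 0 < beta, 0 < a,
       forall y : int, occ I y -> g y = a * (expR (beta * y%:~R) - 1),
       sigma = theta - beta
     & P = (expR beta - 1) * (expR sigma + a)])).
Proof.
move=> ts IN; have [p1|//] := asymmetric_or_equal.
have Q0 := left_jump0 p1; split=> //; split=> //.
have b0 : theta - sigma != 0 by rewrite subr_eq0; apply/eqP.
set b := theta - sigma in b0.
have etE : expR theta = expR b * expR sigma by rewrite -expRD subrK.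
have [g0 gpos] : g 0 = 0 /\ forall y, 1 <= y -> 0 < g y.
  by move: adm; rewrite IN => -[].
have P0 : 0 < P by apply: right_rate_gt0; rewrite g0 gpos.
have := affine_solution b0 rate_recursion.
rewrite Q0 addr0 g0 /=; set k := _ / _ => sol.
have rn : 1 - expR b != 0.
  by rewrite subr_eq0 -expR0 (inj_eq (@expR_inj R)) eq_sym.
have kE : k * (1 - expR b) = P + expR sigma - expR theta by rewrite /k divfK.
have k1 : 0 < k * (1 - expR b).
  have := sol 1 (occS (occ0 I)); rewrite mulr1 => e.
  by have := gpos 1 isT; rewrite e; lra.
have [bneg|bpos|b00] := ltgtP b 0; last by rewrite b00 eqxx in b0.
- have r1 : 0 < 1 - expR b by rewrite subr_gt0 -expR0 ltr_expR.
  have k0 : 0 < k by rewrite -(pmulr_lgt0 _ r1).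
  left; exists k, (- b); split=> //.
  + by rewrite oppr_gt0.
  + by move=> y oy; rewrite sol // opprK; ring.
  + split; first by rewrite /b; ring.
    (* [P] equals [(1 - expR b) * (k - expR sigma)], so its positivity is the bound on [sigma]. *)
    rewrite -ltr_expR lnK // -subr_gt0 -(pmulr_rgt0 _ r1).
    by apply: lt_le_trans P0 _; rewrite mulrBr mulrC kE etE; lra.
  + by rewrite opprK mulrBr mulrC kE etE; ring.
- have r1 : 1 - expR b < 0 by rewrite subr_lt0 -expR0 ltr_expR.
  have k0 : 0 < - k by rewrite oppr_gt0 -(nmulr_lgt0 _ r1).
  right; exists (- k), b; split=> //.
  + by move=> y oy; rewrite sol //; ring.
  + by rewrite /b; ring.
  + transitivity (k * (1 - expR b) - expR sigma + expR theta).
      by rewrite kE; ring.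
    by rewrite etE; ring.
Qed.

(** Here [g y = A * expR (b * y) + k]. Monotonicity gives [A] the sign of [b]; both negative would
    send [g] to minus infinity on the left, so both are positive. The left limit [k] is then
    nonnegative. *)
Lemma shock_exponential_AllInts : theta <> sigma -> I = AllInts ->
  p = 1 /\ Q = 0 /\
  exists a b beta : R,
     [/\ [/\ 0 < beta, 0 < a, 0 <= b &
          forall y : int, occ I y -> g y = a * expR (beta * y%:~R) + b],
       b < expR sigma, sigma = theta - beta
     & P = (expR beta - 1) * (expR sigma - b)].
Proof.
move=> ts IA; have [p1|//] := asymmetric_or_equal.
have Q0 := left_jump0 p1; split=> //; split=> //.
have b0 : theta - sigma != 0 by rewrite subr_eq0; apply/eqP.
set b := theta - sigma in b0.
have etE : expR theta = expR b * expR sigma by rewrite -expRD subrK.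
have oA y : occ I y by rewrite IA.
have gpos y : 0 < g y by move: adm; rewrite IA => -[].
have := affine_solution b0 rate_recursion.
rewrite Q0 addr0 /=; set k := _ / _; set A := g 0 - k => sol.
have rn : 1 - expR b != 0.
  by rewrite subr_eq0 -expR0 (inj_eq (@expR_inj R)) eq_sym.
have kE : k * (1 - expR b) = P + expR sigma - expR theta by rewrite /k divfK.
have A0 : A != 0.
  apply/eqP => A0; have [y [z [oy oz]]] := nonconstant; apply.
  by rewrite (sol y) // (sol z) // A0 !mul0r.
have g01 : g 0 <= g 1 by case: adm => _ mono _ _; exact: mono.
have g1E : g 1 - g 0 = A * (expR b - 1).
  by rewrite (sol 1) // mulr1 /A; ring.
have low n : expR (b * (- n%:Z)%:~R) = (expR (b * n%:R))^-1.
  by rewrite -expRN mulrNz mulrN.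
have [bneg|bpos|b00] := ltgtP b 0; last by rewrite b00 eqxx in b0.
- have r1 : expR b - 1 < 0 by rewrite subr_lt0 -expR0 ltr_expR.
  have An : A < 0.
    rewrite lt_neqAle A0 /= -(nmulr_lge0 _ r1) -g1E subr_ge0 //.
  exfalso.
  (* For [n > x] the bound [1 + t <= expR t] gives [g (- n) <= A - A * b * n + k < 0]. *)
  pose x := (`|k| + 1) / (A * b).
  have Ab : 0 < A * b by rewrite nmulr_rgt0.
  have [n xn] : exists n : nat, x < n%:R.
    by exists (Num.bound x); rewrite archi_boundP // divr_ge0 ?addr_ge0 // ltW.
  have := gpos (- n%:Z); rewrite sol // mulrNz mulrN ltNge => /negP; apply.
  have := expR_ge1Dx (- (b * n%:R)); rewrite -(ler_nM2l An) => le1.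
  have := ler_norm k; move: xn; rewrite ltr_pdivrMr // => xn lek.
  by rewrite [X in expR (- (b * X))](_ : _ = n%:R) //; nra.
have r1 : 0 < expR b - 1 by rewrite subr_gt0 -expR0 ltr_expR.
have Ap : 0 < A.
  by rewrite lt_neqAle eq_sym A0 /= -(pmulr_lge0 _ r1) -g1E subr_ge0.
have k0 : 0 <= k.
  rewrite leNgt; apply/negP => kn.
  (* For [n > x] the bound [1 + t <= expR t] makes [A + k * expR (b * n)] negative, and this is
     [g (- n)] times a positive factor. *)
  pose x := A / (- k * b).
  have kb : 0 < - k * b by rewrite mulr_gt0 // oppr_gt0.
  have [n xn] : exists n : nat, x < n%:R.
    by exists (Num.bound x); rewrite archi_boundP // divr_ge0 // ltW.
  have := gpos (- n%:Z); rewrite sol // low ltNge => /negP; apply.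
  have e0 := expR_gt0 (b * n%:R).
  rewrite -(pmulr_lle0 _ e0) mulrDl mulfVK ?lt0r_neq0 //.
  have := expR_ge1Dx (b * n%:R); move: xn; rewrite ltr_pdivrMr // => xn.
  by rewrite -(ler_nM2l kn); nra.
have P0 : 0 < P.
  by apply: right_rate_gt0; rewrite -subr_gt0 g1E mulr_gt0.
have PE : P = (expR b - 1) * (expR sigma - k).
  transitivity (k * (1 - expR b) - expR sigma + expR theta).
    by rewrite kE; ring.
  by rewrite etE; ring.
exists A, k, b; split=> //.
- by rewrite -subr_gt0 -(pmulr_rgt0 _ r1) -PE.
- by rewrite /b; ring.
Qed.

End classification.

Local Close Scope classical_set_scope.

Theorem theorem3p1 (R : realType) (I : occupation_range) (p : R)
    (g : int -> R) (theta sigma : R) (muhat : int -> R)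
    (nu : int -> probability pair_space R)
    (hp : 0 < p <= 1) (hg : admissible I g)
    (htheta : (theta_inf I g < theta%:E < theta_sup g)%E)
    (hsigma : (theta_inf I g < sigma%:E < theta_sup g)%E)
    (hmuhat : mass_function I muhat)
    (hnu : forall j : int,
       is_product_measure (nu j) (shock_marginals I g theta sigma muhat j))
    (P Q : R) :
  random_walking_shock p g nu P Q <->
  [\/ (exists a : R,
         [/\ I = NonNegInts,
             0 < a /\ (forall y : int, occ I y -> g y = a * y%:~R),
             theta = sigma,
             muhat = stationary_marginal I g theta /\
             muhat = stationary_marginal I g sigma
           & P = p * a /\ Q = (1 - p) * a]),
      (exists a beta : R,
         [/\ I = NonNegInts /\ p = 1,
             [/\ 0 < beta, 0 < a &
               forall y : int, occ I y -> g y = a * (1 - expR (- beta * y%:~R))],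
             theta + beta = sigma /\ sigma < ln a,
             muhat = stationary_marginal I g sigma
           & P = (1 - expR (- beta)) * (a - expR sigma) /\ Q = 0]),
      (exists a beta : R,
         [/\ I = NonNegInts /\ p = 1,
             [/\ 0 < beta, 0 < a &
               forall y : int, occ I y -> g y = a * (expR (beta * y%:~R) - 1)],
             sigma = theta - beta,
             muhat = stationary_marginal I g sigma
           & P = (expR beta - 1) * (expR sigma + a) /\ Q = 0])
    | (exists a b beta : R,
         [/\ I = AllInts /\ p = 1,
             [/\ 0 < beta, 0 < a, 0 <= b &
               forall y : int, occ I y -> g y = a * expR (beta * y%:~R) + b],
             (lne b%:E < sigma%:E)%E /\ sigma = theta - beta,
             muhat = stationary_marginal I g sigma
           & P = (expR beta - 1) * (expR sigma - b) /\ Q = 0])].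
Proof.
have hnu' j : is_product_measure (nu j)
    (marginals (stationary_marginal I g theta) (stationary_marginal I g sigma)
      muhat j) by exact: hnu.
have [p0 p1] := andP hp.
split=> [rws|].
  have mhE := muhat_stationary hg hp hmuhat hnu' rws.
  have [ts|ts] := pselect (theta = sigma).
    apply: Or41.
    have [a [IN ag PQ]] := shock_linear hg hp hmuhat hnu' rws ts.
    by exists a; split=> //; rewrite mhE ts.
  have [IN|IA] : I = NonNegInts \/ I = AllInts by case: (I); [left|right].
    have [pE [Q0 [[a [b [b0 a0 ga sb PE]]]|[a [b [b0 a0 ga sb PE]]]]]] :=
      shock_exponential_NonNegInts hg hp hmuhat hnu' rws ts IN.
    - by apply: Or42; exists a, b.
    - by apply: Or43; exists a, b.
  have [pE [Q0 [a [b [beta [ab bs sb PE]]]]]] :=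
    shock_exponential_AllInts hg hp hmuhat hnu' rws ts IA.
  apply: Or44; exists a, b, beta; split=> //; split=> //.
  (* For [b = 0] the extended logarithm is minus infinity and the bound is automatic; otherwise
     exponentials are compared. *)
  by rewrite /lne; case: ifPn => [_|b0]; rewrite ?ltNyr // lte_fin
    -ltr_expR lnK // qualifE /= ltNge.
case=> [[a [IN [a0 ga] ts [_ mhE] [-> ->]]]|||].
- rewrite mhE in hnu'; apply: (shock_sufficient_both hg hnu') => //.
  + by rewrite ltW.
  + exact: ltW.
  + move=> y oy; rewrite !ga //; last exact: occS.
    by rewrite rmorphD /= mulrDr mulr1.
- move=> [a [b [[IN pE] [b0 a0 ga] [ts sa] mhE [PE ->]]]].
  rewrite mhE in hnu'; rewrite pE.
  have sa' : expR sigma < a by rewrite -[a]lnK // ltr_expR.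
  have r1 : expR (- b) < 1 by rewrite -expR0 ltr_expR oppr_lt0.
  have tsE : theta - sigma = - b by rewrite -ts; ring.
  have etE : expR theta = expR (- b) * expR sigma by rewrite -expRD -ts; congr expR; ring.
  (* The first summand is the constant [c] of the affine recursion of [g]; the two cases below
     rewrite [P] in the same way. *)
  have -> : P = a * (1 - expR (- b)) + expR theta - expR sigma by rewrite PE etE; ring.
  apply: (shock_sufficient_right hg hnu').
    move=> y oy; rewrite !ga //; last exact: occS.
    by rewrite tsE expR_mulz_succ; ring.
  rewrite etE (_ : _ - _ = (1 - expR (- b)) * (a - expR sigma)); last by ring.
  by rewrite mulr_ge0 // subr_ge0 ltW.
- move=> [a [b [[IN pE] [b0 a0 ga] ts mhE [PE ->]]]].
  rewrite mhE in hnu'; rewrite pE.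
  have r1 : 1 < expR b by rewrite expR_gt1.
  have tsE : theta - sigma = b by rewrite ts; ring.
  have etE : expR theta = expR b * expR sigma by rewrite -expRD ts; congr expR; ring.
  have -> : P = a * (expR b - 1) + expR theta - expR sigma by rewrite PE etE; ring.
  apply: (shock_sufficient_right hg hnu').
    move=> y oy; rewrite !ga //; last exact: occS.
    by rewrite tsE expR_mulz_succ; ring.
  rewrite etE (_ : _ - _ = (expR b - 1) * (expR sigma + a)); last by ring.
  by rewrite mulr_ge0 ?subr_ge0 ?ltW // addr_gt0 // expR_gt0.
- move=> [a [b [beta [[IA pE] [beta0 a0 b0 ga] [bs ts] mhE [PE ->]]]]].
  rewrite mhE in hnu'; rewrite pE.
  have r1 : 1 < expR beta by rewrite expR_gt1.
  have sb : b < expR sigma.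
    move: bs; rewrite /lne; case: ifPn => [b0' _|bn].
      exact: le_lt_trans b0' (expR_gt0 _).
    by rewrite lte_fin -[in X in _ -> X](@lnK _ b) ?ltr_expR // qualifE /= ltNge.
  have tsE : theta - sigma = beta by rewrite ts; ring.
  have etE : expR theta = expR beta * expR sigma by rewrite -expRD ts; congr expR; ring.
  have -> : P = b * (1 - expR beta) + expR theta - expR sigma by rewrite PE etE; ring.
  apply: (shock_sufficient_right hg hnu').
    move=> y oy; rewrite !ga //; last exact: occS.
    by rewrite tsE expR_mulz_succ; ring.
  rewrite etE (_ : _ - _ = (expR beta - 1) * (expR sigma - b)); last by ring.
  by rewrite mulr_ge0 // subr_ge0 ltW.
Qed.
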